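(* Let $\omega$ be a finite positive Borel measure on $[0,1)$. Then the following conditions are equivalent: (i) $\omega\in\widehat{\mathcal{D}}$; (ii) there exist $C=C(\omega)\ge1$ and $\beta=\beta(\omega)>0$ such that $\widehat{\omega}(r)\le C\left(\frac{1-r}{1-t}\right)^{\beta}\widehat{\omega}(t)$ for all $0\le r\le t<1$; (iii) there exist $C=C(\omega)>0$ and $\gamma=\gamma(\omega)>0$ such that $\int_0^t\left(\frac{1-t}{1-s}\right)^\gamma d\omega(s)\le C\widehat{\omega}(t)$ for all $0\le t<1$; (iv) there exist constants $C_0=C_0(\omega)>0$ and $C=C(\omega)>0$ such that $\widehat{\omega}(0)\le C_0\widehat{\omega}\left(\frac12\right)$ and $\int_0^ts^{\frac1{1-t}}\,d\omega(s)\le C\widehat{\omega}(t)$ for all $0\le t<1$; (v) there exist constants $C_0=C_0(\omega)>0$ and $C=C(\omega)>0$ such that $\widehat{\omega}(0)\le C_0\widehat{\omega}\left(\frac12\right)$ and $\widehat{\omega}(r)\le Cr^{-\frac1{1-t}}\widehat{\omega}(t)$ for all $0\le r\le t<1$; (vi) there exists $C_0=C_0(\omega)>0$ with $\widehat{\omega}(0)\le C_0\widehat{\omega}\left(\frac12\right)$, and $\int_0^1s^x\,d\omega(s)\asymp\widehat{\omega}\left(1-\frac1x\right)$ for $x\in[1,\infty)$; (vii) there exists $\lambda=\lambda(\omega)\ge0$ such that $$\int_{\mathbb{D}}\frac{d(\omega\otimes m)(z)}{|1-\overline{\zeta}z|^{\lambda+1}}\asymp\frac{\widehat{\omega}(\zeta)}{(1-|\zeta|)^\lambda},\qquad\zeta\in\mathbb{D};$$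 (viii) there exists $C_0=C_0(\omega)>0$ with $\widehat{\omega}(0)\le C_0\widehat{\omega}\left(\frac12\right)$, and $\omega^\star(z)\asymp\widehat{\omega}(z)(1-|z|)$ for $|z|\ge\frac12$; (ix) there exists $C_0=C_0(\omega)>0$ with $\widehat{\omega}(0)\le C_0\widehat{\omega}\left(\frac12\right)$, and there exists $C=C(\omega)>0$ such that $\omega_n\le C\omega_{2n}$ for all $n\in\mathbb{N}$; (x) there exists $C_0=C_0(\omega)>0$ with $\widehat{\omega}(0)\le C_0\widehat{\omega}\left(\frac12\right)$, and there exist $C=C(\omega)>0$ and $\eta=\eta(\omega)>0$ such that $\omega_x\le C\left(\frac yx\right)^{\eta}\omega_y$ for all $0<x\le y<\infty$; (xi) there exist $K=K(\omega)>1$ and $C=C(\omega,K)>1$ such that $1-\rho_n(\omega,K)\ge C\left(1-\rho_{n+1}(\omega,K)\right)$ for all $n\in\mathbb{N}\cup\{0\}$. Moreover, if $\omega\in\widehat{\mathcal{D}}$, there exists $C=C(\omega)>0$ such that $$\int_0^r\frac{dt}{\widehat{\omega}(t)(1-t)}\ge\frac{C}{\widehat{\omega}(r)},\qquad r\in\left[\tfrac12,1\right).$$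
   Context: $\mathbb{D}$ is the open unit disc. For a finite positive Borel measure $\omega$ on $[0,1)$, put $\widehat{\omega}(z)=\int_{|z|}^1d\omega(t)$ for all $z\in\mathbb{D}$. Write $\omega\in\widehat{\mathcal{D}}$ if there is $C=C(\omega)>0$ with $\widehat{\omega}(r)\le C\,\widehat{\omega}\left(\frac{1+r}{2}\right)$ for all $r\in[0,1)$. For $z=re^{i\theta}\in\mathbb{D}$, $d(\omega\otimes m)(z)=\frac{1}{\pi}\,d\theta\,r\,d\omega(r)$. For $x>-1$, $\omega_x=\int_0^1r^x\,d\omega(r)$. $\omega^\star(z)=\int_{|z|}^1\log\frac{s}{|z|}\,s\,d\omega(s)$ for $z\in\mathbb{D}\setminus\{0\}$. For each $K>1$, $\rho_n=\rho_n(\omega,K)$ is the sequence defined by $\widehat{\omega}(\rho_n)=\widehat{\omega}(0)K^{-n}$. $a\asymp b$ means two-sided inequalities with positive constants independent of the variable involved.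
   Formalization: In (xi), ρ_n is taken as sup{r in [0,1): ω̂(r) ≥ ω̂(0)K^{-n}}, the greatest solution of the defining equation whenever one exists, since for ω with atoms the equation may have no solution and (i)⇒(xi) would then fail. *)

(* Defs.v *)
From HB Require Import structures.
From mathcomp Require Import all_boot all_order all_algebra.
From mathcomp Require Import all_classical all_reals all_analysis.
From mathcomp Require Import complex.
Set Implicit Arguments.
Unset Strict Implicit.
Unset Printing Implicit Defensive.
Import Order.TTheory GRing.Theory Num.Theory.
Import numFieldNormedType.Exports.

Local Open Scope classical_set_scope.
Local Open Scope ring_scope.

(* The modulus of a complex number as an element of R; the norm [`|z|] that
   the library puts on R[i] takes its values in R[i]. *)
Notation cmod := (@Normc.normc _).

(* Borel measures on [0, 1) are finite Borel measures on the line that vanish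
   off [0, 1).  Atoms are allowed; throughout, [\int_a^b ... d omega] is read
   as an integral over the half-open interval [a, b), so that it is additive
   in the interval and [hat omega 0] is the total mass. *)
Definition on_unit (R : realType)
    (omega : {finite_measure set (measurableTypeR R) -> \bar R}) : Prop :=
  omega (~` `[0, 1[%classic) = 0%E.

(* [hat omega x] is the value of the radial function omega-hat at all the
   points z of the unit disc with |z| = x. *)
Definition hat (R : realType)
    (omega : {finite_measure set (measurableTypeR R) -> \bar R}) (x : R) : R :=
  fine (omega `[x, 1[%classic).

Definition Dhat (R : realType)
    (omega : {finite_measure set (measurableTypeR R) -> \bar R}) : Prop :=
  exists2 C : R, 0 < C &
    forall r : R, 0 <= r < 1 -> hat omega r <= C * hat omega ((1 + r) / 2).

(* Only used for x > 0.  (In the library [0 `^ x = 0] for x < 0 as well.) *)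
Definition moment (R : realType)
    (omega : {finite_measure set (measurableTypeR R) -> \bar R}) (x : R)
    : \bar R :=
  (\int[omega]_(r in `[0%R, 1%R[) (r `^ x)%:E)%E.

(* The integral over the unit disc, in polar coordinates, of a nonnegative
   function f against omega (x) m. *)
Definition disc_integral (R : realType)
    (omega : {finite_measure set (measurableTypeR R) -> \bar R})
    (f : R[i] -> R) : \bar R :=
  ((pi^-1)%:E * \int[omega]_(r in `[0%R, 1%R[)
     (r%:E * \int[lebesgue_measure]_(t in `[0%R, (2 * pi)%R[)
        (f (Complex (r * cos t) (r * sin t)))%:E))%E.

Definition omega_star (R : realType)
    (omega : {finite_measure set (measurableTypeR R) -> \bar R}) (z : R[i])
    : \bar R :=
  (\int[omega]_(s in `[cmod z, 1%R[) (ln (s / cmod z) * s)%:E)%E.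

(* The equation [hat omega r = hat omega 0 * K ^- n] may have no solution r if
   omega has atoms, and several if omega-hat is constant on an interval.  By
   [hat_rho], the supremum below is the greatest solution whenever there is
   one, in particular for all n if K > 1 and omega is nonzero and atomless. *)
Definition rho (R : realType)
    (omega : {finite_measure set (measurableTypeR R) -> \bar R}) (K : R)
    (n : nat) : R :=
  sup [set r : R | 0 <= r < 1 /\ hat omega 0 * K ^- n <= hat omega r].

Definition asymp_on (R : realType) (T : Type) (D : set T) (f g : T -> \bar R)
    : Prop :=
  exists c C : R, [/\ 0 < c, 0 < C &
    forall x, D x -> (c%:E * g x <= f x)%E /\ (f x <= C%:E * g x)%E].

Lemma hat_le (R : realType)
    (omega : {finite_measure set (measurableTypeR R) -> \bar R}) (x y : R) :
  x <= y -> hat omega y <= hat omega x.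
Proof.
move=> xy; apply: fine_le; rewrite ?fin_num_measure//.
apply: le_measure; rewrite ?inE//.
by apply: subset_itvr; rewrite bnd_simp.
Qed.

Lemma hat_left_limit (R : realType)
    (omega : {finite_measure set (measurableTypeR R) -> \bar R}) (c x : R) :
  (forall y, y < x -> c <= hat omega y) -> c <= hat omega x.
Proof.
move=> cy.
pose F (k : nat) : set (measurableTypeR R) := `[x - k.+1%:R^-1, 1[%classic.
have capF : \bigcap_k F k = `[x, 1[%classic.
  apply/seteqP; split => y /=; last first.
    move=> /[!in_itv]/= /andP[xy y1] k _; rewrite /F/= in_itv/= y1 andbT.
    by rewrite (le_trans _ xy)// gerBl.
  move=> Fy; have := Fy 0%N I; rewrite /F/= in_itv/= => /andP[_ y1].
  rewrite in_itv/= y1 andbT leNgt; apply/negP => yx.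
  have [k _ /(_ k (leqnn k))] : \forall k \near \oo, k.+1%:R^-1 < x - y.
    apply: near_infty_natSinv_lt (PosNum _); by rewrite subr_gt0.
  rewrite /= => kxy.
  have := Fy k I; rewrite /F/= in_itv/= => /andP[+ _].
  by rewrite lerBlDr -lerBlDl leNgt kxy.
have cvF : omega (F n) @[n --> \oo] --> omega (\bigcap_n F n).
  apply: nonincreasing_cvg_mu => //.
  - by rewrite ltey_eq fin_num_measure //; exact: measurable_itv.
  - by move=> i; exact: measurable_itv.
  - by rewrite capF; exact: measurable_itv.
  - move=> m n mn; apply/subsetPset; apply: subset_itvr; rewrite bnd_simp.
    by rewrite lerD2l lerN2 lef_pV2 ?posrE// ler_nat ltnS.
rewrite -lee_fin /hat fineK ?fin_num_measure// -capF -(cvg_lim _ cvF)//.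
apply: lime_ge; first by apply/cvg_ex; exists (omega (\bigcap_n F n)).
apply: nearW => n; have := cy (x - n.+1%:R^-1).
rewrite ltrBlDr ltrDl invr_gt0 ltr0n => /(_ isT).
by rewrite -lee_fin /hat fineK ?fin_num_measure.
Qed.

Lemma hat_rho (R : realType)
    (omega : {finite_measure set (measurableTypeR R) -> \bar R}) (K : R)
    (n : nat) (r : R) :
  0 <= r < 1 -> hat omega r = hat omega 0 * K ^- n ->
  r <= rho omega K n /\ hat omega (rho omega K n) = hat omega 0 * K ^- n.
Proof.
move=> r01 hr; rewrite /rho; set S := [set r | _].
have Sr : S r by split=> //; rewrite hr.
have supS : has_sup S.
  by split; [exists r | exists 1 => y [/andP[_ /ltW]]].
have rS : r <= sup S by exact: (ub_le_sup supS.2).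
split=> //; apply/eqP; rewrite eq_le; apply/andP; split.
  by rewrite -hr; exact: hat_le.
apply: hat_left_limit => y yS.
have [s [_ cs] ys] := sup_gt (ex_intro _ r Sr) yS.
by rewrite (le_trans cs)// hat_le// ltW.
Qed.

(* Main.v *)
Require Import Defs.
From HB Require Import structures.
From mathcomp Require Import all_boot all_order all_algebra.
From mathcomp Require Import all_classical all_reals all_analysis.
From mathcomp Require Import complex.
From mathcomp Require Import measurable_realfun ring lra.
Set Implicit Arguments.
Unset Strict Implicit.
Unset Printing Implicit Defensive.
Import Order.TTheory GRing.Theory Num.Theory.
Import numFieldNormedType.Exports.
Local Open Scope classical_set_scope.
Local Open Scope ring_scope.

(** Halving 1 - r costs at most a constant factor of hat omega: that is the
class, and every other condition says it in a different gauge.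

Iterating the halving turns the factor into a power of (1 - r) / (1 - t)
[Dhat_power_decay].  The same iteration, run for the quantity
F(t) = \int_[0, t) ((1 - t) / (1 - s))^g d omega(s), gives
F(t) <= 2^-g F(2t - 1) + hat omega (2t - 1), which is contracting once 2^g
exceeds the doubling constant; hence F is bounded by a multiple of hat omega
[Dhat_ratio_integral].  Since u^g <= g^g e^u, the weight s^(1/(1-t)) lies below
a multiple of ((1 - t) / (1 - s))^g; restricting its integral to [r, t) yields
the pointwise bound with r^(-1/(1-t)), and for t = (1 + r) / 2 that factor is
bounded, so one is back at the doubling condition
[ratio_integral_power_integral], [power_integral_power_decay],
[base_power_decay_Dhat].

On [1 - 1/x, 1) the weight s^x is comparable to 1, so the moment of order x is
at least a multiple of hat omega (1 - 1/x), and the integral bound above is the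
matching upper estimate.  If conversely the moments double, an N-th moment with
N = 2^k n is at most a small multiple of C^-k times the n-th one plus
hat omega (1 - 1/n); absorbing the first term for a large k bounds the n-th
moment by hat omega (1 - 1/n) [moment_doubling_le_hat].

Near the unit circle log(s/r) s is comparable to s - r, so omega-star is at most
2 (1 - r) hat omega (r), and the opposite bound prevents the mass of
[r, 1) from concentrating near r [star_asymp_Dhat].  The levels rho_n are where
hat omega passes hat omega (0) K^-n: geometric decay of 1 - rho_n says that a
fixed number of levels halves 1 - r [rho_Dhat].

For the disc, the mean of |1 - rho e^(iu)|^-(lambda+1) over the circle is
comparable to (1 - rho)^-lambda; its upper bound reduces to the exponent 2,
where the integrand is dominated by the derivative of
atan (sin u / (1 - rho)) / (1 - rho) [circle_integral_le],
[circle_integral_ge].  The integral over the disc thus becomes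
\int r (1 - |zeta| r)^-lambda d omega(r) [radial_integral], which is split at
|zeta| and compared with F.

Atoms make hat omega jump, so the arguments rest on its monotonicity alone and,
for the levels, on its left-continuity. *)

(** * Integrals of nonnegative functions *)

Section IntegralComparison.
Context d (T : measurableType d) (R : realType) (mu : {measure set T -> \bar R}).
Local Open Scope ereal_scope.

(** The integral of a nonnegative function is the supremum over the simple functions
below it, hence monotone for arbitrary functions.  It is applied to circle
integrals depending on a parameter and to the reciprocal of the tail. *)
Lemma integral_le_pointwise (D : set T) (f g : T -> \bar R) :
  (forall x, D x -> 0 <= f x) -> (forall x, D x -> f x <= g x) ->
  \int[mu]_(x in D) f x <= \int[mu]_(x in D) g x.
Proof.
move=> f0 fg.
have g0 x : D x -> 0 <= g x by move=> Dx; rewrite (le_trans (f0 _ Dx)) ?fg.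
rewrite !ge0_integralE//; apply: le_ereal_sup => _ [h /= hf <-].
exists h => //= x; apply: (le_trans (hf x)).
by rewrite /patch; case: ifPn => //; rewrite inE => /fg.
Qed.

Lemma integral_ge_cst_on (D E : set T) (f : T -> \bar R) (c : R) :
  measurable E -> E `<=` D -> (0 <= c)%R ->
  (forall x, D x -> 0 <= f x) -> (forall x, E x -> c%:E <= f x) ->
  c%:E * mu E <= \int[mu]_(x in D) f x.
Proof.
move=> mE ED c0 f0 cf; rewrite -integral_cst// integral_mkcond.
rewrite [leRHS]integral_mkcond; apply: integral_le_pointwise => x _.
  by rewrite /patch; case: ifPn => //=; rewrite lee_fin.
rewrite /patch; case: ifPn => [|_]; rewrite ?inE.
  by move=> Ex; rewrite ifT ?inE; [exact: cf|exact: ED].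
by case: ifPn => //; rewrite inE => /f0.
Qed.

Lemma integral_le_cst_on (D : set T) (f : T -> \bar R) (c : R) :
  measurable D -> (forall x, D x -> 0 <= f x) ->
  (forall x, D x -> f x <= c%:E) ->
  \int[mu]_(x in D) f x <= c%:E * mu D.
Proof.
by move=> mD f0 fc; rewrite -integral_cst//; exact: integral_le_pointwise.
Qed.

End IntegralComparison.

Section Hat.
Context (R : realType) (omega : {finite_measure set (measurableTypeR R) -> \bar R}).

Lemma hatE (x : R) : omega `[x, 1[%classic = (hat omega x)%:E.
Proof. by rewrite /hat fineK// fin_num_measure//; exact: measurable_itv. Qed.

Lemma hat_ge0 (x : R) : 0 <= hat omega x.
Proof. by rewrite -lee_fin -hatE. Qed.

Lemma hat1 : hat omega 1 = 0.
Proof. by rewrite /hat set_itv_ge ?measure0// bnd_simp ltxx. Qed.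

Lemma measure_itv_hat (a b : R) : a <= b -> b <= 1 ->
  omega `[a, b[%classic = (hat omega a - hat omega b)%:E.
Proof.
move=> ab b1.
have split : `[a, 1[%classic = `[a, b[%classic `|` `[b, 1[%classic :> set R.
  by apply: itv_bndbnd_setU; rewrite bnd_simp.
have : omega `[a, 1[%classic = (omega `[a, b[%classic + omega `[b, 1%R[%classic)%E.
  rewrite split measureU//.
  apply/seteqP; split => // x /= []; rewrite !in_itv/= => /andP[_ xb] /andP[bx _].
  by move: (lt_le_trans xb bx); rewrite ltxx.
rewrite !hatE EFinB => ->; rewrite addeK//.
Qed.

Lemma integral_itv_split (a b c : R) (f : R -> R) :
  a <= b -> b <= c -> measurable_fun `[a, c[ f ->
  (forall x, a <= x < c -> 0 <= f x) ->
  (\int[omega]_(s in `[a, c[) (f s)%:E =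
   \int[omega]_(s in `[a, b[) (f s)%:E + \int[omega]_(s in `[b, c[) (f s)%:E)%E.
Proof.
move=> ab bc mf f0.
have split : `[a, c[%classic = `[a, b[%classic `|` `[b, c[%classic :> set R.
  by apply: itv_bndbnd_setU; rewrite bnd_simp.
rewrite split ge0_integral_setU//.
- by rewrite -split; apply/measurable_EFinP.
- by move=> x; rewrite -split /= in_itv/= => /f0; rewrite lee_fin.
- apply/disj_setPS => x /= []; rewrite !in_itv/= => /andP[_ xb] /andP[bx _].
  by move: (lt_le_trans xb bx); rewrite ltxx.
Qed.

Lemma integral_itvZ (a b k : R) (f : R -> R) :
  0 <= k -> measurable_fun `[a, b[ f -> (forall x, a <= x < b -> 0 <= f x) ->
  (\int[omega]_(s in `[a, b[) (k * f s)%:E =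
   k%:E * \int[omega]_(s in `[a, b[) (f s)%:E)%E.
Proof.
move=> k0 mf f0; rewrite -ge0_integralZl_EFin//.
exact/measurable_EFinP.
Qed.

Lemma integral_itv_mono (a b : R) (f g : R -> R) :
  (forall x, a <= x < b -> 0 <= f x <= g x) ->
  (\int[omega]_(s in `[a, b[) (f s)%:E <= \int[omega]_(s in `[a, b[) (g s)%:E)%E.
Proof.
move=> fg; apply: integral_le_pointwise => x /=; rewrite in_itv/= lee_fin;
  by move=> /fg /andP[].
Qed.

(** Restriction to [c, d) of a bound from below: the way in which an integral
condition is turned into a condition on the tail. *)
Lemma integral_itv_ge (a b c d k : R) (f : R -> R) : 0 <= k ->
  a <= c -> c <= d -> d <= b -> d <= 1 ->
  (forall x, a <= x < b -> 0 <= f x) -> (forall x, c <= x < d -> k <= f x) ->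
  ((k * (hat omega c - hat omega d))%:E <= \int[omega]_(s in `[a, b[) (f s)%:E)%E.
Proof.
move=> k0 ac cd db d1 f0 kf.
rewrite EFinM -measure_itv_hat//; apply: integral_ge_cst_on => //.
by apply: subset_itv; rewrite bnd_simp.
Qed.

Lemma integral_itv_le (a b k : R) (f : R -> R) :
  a <= b -> b <= 1 ->
  (forall x, a <= x < b -> 0 <= f x <= k) ->
  (\int[omega]_(s in `[a, b[) (f s)%:E <= (k * (hat omega a - hat omega b))%:E)%E.
Proof.
move=> ab b1 fk.
rewrite EFinM -measure_itv_hat//; apply: integral_le_cst_on => //.
- by move=> x /=; rewrite in_itv/= lee_fin => /fk /andP[].
- by move=> x /=; rewrite in_itv/= lee_fin => /fk /andP[].
Qed.

End Hat.

(** * Elementary inequalities *)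

Section RealBounds.
Context (R : realType).
Implicit Types x y s t u g : R.

Lemma powR_ge1 x y : 1 <= x -> 0 <= y -> 1 <= x `^ y.
Proof. by move=> x1 y0; rewrite -(powRr0 x) ler_powR. Qed.

Lemma powR_le_base y u v : 0 <= y -> 0 <= u -> u <= v -> u `^ y <= v `^ y.
Proof.
by move=> y0 u0 uv; apply: ge0_ler_powR => //; rewrite nnegrE// (le_trans u0).
Qed.

Lemma powR_le1 x y : 0 <= x <= 1 -> 0 <= y -> x `^ y <= 1.
Proof. by move=> /andP[x0 x1] y0; have := powR_le_base y0 x0 x1; rewrite powR1. Qed.

(** The exponents beta and gamma are logarithms in base 2 of doubling constants. *)
Lemma powR2_log2 x : 0 < x -> 2 `^ (ln x / ln 2) = x.
Proof.
move=> x0; rewrite /powR pnatr_eq0/= divfK ?lnK ?posrE//.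
by rewrite gt_eqF// ln_gt0// ltr1n.
Qed.

(** This is u / g <= e ^ (u / g), raised to the power g. *)
Lemma powR_le_expR g u : 0 < g -> 0 < u -> u `^ g <= g `^ g * expR u.
Proof.
move=> g0 u0; have ug0 : 0 < u / g by rewrite divr_gt0.
rewrite /powR !gt_eqF// -expRD ler_expR.
have -> : ln u = ln g + ln (u / g).
  by rewrite -lnM ?posrE// mulrC divfK// gt_eqF.
rewrite mulrDr lerD2l -ler_pdivlMl// [leRHS]mulrC.
by apply: ltW; exact: ln_sublinear.
Qed.

(** Follows from ln s <= s - 1; the case s = 0 holds because 0 to a nonzero power
is 0. *)
Lemma powR_le_expRN s x : 0 <= s -> 0 < x -> s `^ x <= expR (- (x * (1 - s))).
Proof.
move=> s0 x0; rewrite /powR; case: ifPn => [_|sn0].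
  by rewrite gt_eqF//= expR_ge0.
have {}s0 : 0 < s by rewrite lt_neqAle eq_sym sn0.
rewrite ler_expR -mulrN ler_pM2l// opprB.
have -> : s = 1 + (s - 1) by ring.
have -> : 1 + (s - 1) - 1 = s - 1 by ring.
by apply: le_ln1Dx; lra.
Qed.

(** A converse to the previous bound away from 0, from - ln s <= 1/s - 1.  With
x (1 - s) bounded it keeps s ^ x away from 0. *)
Lemma expRN_le_powR s x : 1 / 2 <= s <= 1 -> 0 <= x ->
  expR (- (2 * x * (1 - s))) <= s `^ x.
Proof.
move=> /andP[s2 s1] x0; have s0 : 0 < s by lra.
rewrite /powR gt_eqF// ler_expR.
have : - ln s <= 2 * (1 - s).
  rewrite -lnV ?posrE//.
  have -> : ln s^-1 = ln (1 + (s^-1 - 1)) by congr ln; ring.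
  have sV0 : 0 < s^-1 by rewrite invr_gt0.
  apply: le_trans (le_ln1Dx _) _; first by lra.
  have e : s * s^-1 = 1 by rewrite mulfV// gt_eqF.
  have : s^-1 <= 2 by rewrite -[2]invrK lef_pV2 ?posrE//; lra.
  by nra.
by nra.
Qed.

(** Both bounds come from ln x <= x - 1, applied to r / s and to s / r. *)
Lemma ln_ratio_bounds (r s : R) : 1 / 2 <= r -> r <= s -> s <= 1 ->
  s - r <= ln (s / r) * s <= 2 * (s - r).
Proof.
move=> r2 rs s1; have r0 : 0 < r by lra. have s0 : 0 < s by lra.
apply/andP; split.
  have -> : s - r = (1 - r / s) * s by rewrite mulrBl mul1r divfK ?gt_eqF.
  rewrite ler_pM2r//.
  have -> : s / r = (r / s)^-1 by rewrite invf_div.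
  have rs0 : 0 < r / s by rewrite divr_gt0.
  rewrite lnV ?posrE// -opprB lerN2.
  have -> : ln (r / s) = ln (1 + (r / s - 1)) by congr ln; ring.
  by apply: le_ln1Dx; lra.
have rV : r^-1 <= 2 by rewrite -[2]invrK lef_pV2 ?posrE//; lra.
have sr0 : 0 < s / r by rewrite divr_gt0.
have h : ln (s / r) <= s / r - 1.
  have -> : ln (s / r) = ln (1 + (s / r - 1)) by congr ln; ring.
  by apply: le_ln1Dx; lra.
have e : s / r - 1 = (s - r) * r^-1 by rewrite mulrBl divff ?gt_eqF.
have : (s - r) * r^-1 <= (s - r) * 2 by rewrite ler_wpM2l//; lra.
by rewrite -e; nra.
Qed.

(** Bernoulli's inequality. *)
Lemma exists_expr_gt (x M : R) : 1 < x -> exists k : nat, M < x ^+ k.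
Proof.
move=> x1; have x10 : 0 < x - 1 by lra.
have bern k : 1 + k%:R * (x - 1) <= x ^+ k.
  elim: k => [|k IH]; first by rewrite mul0r addr0 expr0.
  rewrite exprS -natr1; have : 0 <= k%:R :> R by exact: ler0n.
  move: IH; move: (x ^+ k) k%:R => p q pq q0.
  have : x * (1 + q * (x - 1)) <= x * p by rewrite ler_pM2l//; lra.
  have : 0 <= q * (x - 1) ^+ 2 by rewrite mulr_ge0// sqr_ge0.
  by lra.
exists (Num.truncn (M / (x - 1))).+1.
apply: lt_le_trans (bern _); have := truncnS_gt (M / (x - 1)).
by rewrite ltr_pdivrMr//; lra.
Qed.

(** Among the powers of 2, the powers 4 ^ j >= (j + 1) ^ 2 already outgrow every
linear function of the exponent. *)
Lemma exists_pow2_ge (L : R) : exists k : nat, 2 + k%:R * L <= 2 ^+ k.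
Proof.
pose j := (Num.truncn `|2 * L|).+1.
have j1 : 1 <= j%:R :> R by rewrite ler1n.
have jL : 2 * L <= j%:R.
  by rewrite (le_trans (ler_norm _))// ltW// truncnS_gt.
exists (j * 2)%N; rewrite exprM natrM.
have : (j.+1)%:R <= 2 ^+ j :> R by rewrite -natrX ler_nat ltn_expl.
rewrite -natr1; set p := 2 ^+ j; set q := j%:R in j1 jL *; move=> qp.
have : (q + 1) ^+ 2 <= p ^+ 2 by rewrite lerXn2r ?nnegrE; lra.
by rewrite !expr2; nra.
Qed.

End RealBounds.

(** * Doubling and power bounds for the tail *)

Section TailConditions.
Context (R : realType) (omega : {finite_measure set (measurableTypeR R) -> \bar R}).
Local Notation hat := (hat omega).

(** Doubling needs to be checked for r >= 1/2 only: for smaller r, compare with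
0 on the left and with 3/4 on the right. *)
Lemma Dhat_of_upper_half (C0 C : R) : 0 < C0 -> 0 < C ->
  hat 0 <= C0 * hat (1 / 2) ->
  (forall r, 1 / 2 <= r < 1 -> hat r <= C * hat ((1 + r) / 2)) -> Dhat omega.
Proof.
move=> C00 Cp h0 hC; exists (C + C0 * C); first by rewrite addr_gt0// mulr_gt0.
move=> r /andP[r0 r1].
have H0 := hat_ge0 omega ((1 + r) / 2).
have [r2|r2] := leP (1 / 2) r.
  apply: le_trans (hC _ _) _; first by rewrite r2.
  by rewrite [leRHS]mulrDl lerDl mulr_ge0// mulr_ge0// ltW.
have h1 : hat r <= hat 0 by apply: hat_le.
have h2 : hat (1 / 2) <= C * hat ((1 + 1 / 2) / 2) by apply: hC; lra.
have h3 : hat ((1 + 1 / 2) / 2) <= hat ((1 + r) / 2) by apply: hat_le; lra.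
apply: (le_trans h1); apply: (le_trans h0).
have h4 : hat (1 / 2) <= C * hat ((1 + r) / 2).
  by rewrite (le_trans h2)// ler_pM2l.
have : C0 * hat (1 / 2) <= C0 * (C * hat ((1 + r) / 2)) by rewrite ler_pM2l.
by move=> h5; rewrite (le_trans h5)// [leRHS]mulrDl mulrA lerDr mulr_ge0// ltW.
Qed.

Lemma Dhat_half_mass : Dhat omega ->
  exists2 C0 : R, 0 < C0 & hat 0 <= C0 * hat (1 / 2).
Proof.
move=> [C C0 hC]; exists C => //.
by have := hC 0; rewrite addr0; apply; rewrite lexx ltr01.
Qed.

(** A constant C >= 2 has positive logarithm in base 2, and the logarithm of 2 C is
at least 1. *)
Lemma Dhat_ge2 : Dhat omega ->
  exists2 C : R, 2 <= C &
    forall r, 0 <= r < 1 -> hat r <= C * hat ((1 + r) / 2).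
Proof.
move=> [C C0 hC]; exists (C + 2) => [|r r01]; first by rewrite lerDr ltW.
apply: le_trans (hC r r01) _.
by rewrite ler_wpM2r ?hat_ge0// lerDl.
Qed.

(** With beta = log2 C, halving 1 - r multiplies ((1 - r) / (1 - t)) ^ beta by 1 / C,
exactly the loss in one doubling step, so the bound is stable under the step
r -> (1 + r) / 2.  Induction on the number k of steps leading from r past t. *)
Lemma Dhat_power_decay : Dhat omega ->
  exists C beta : R, [/\ 1 <= C, 0 < beta &
      forall r t : R, 0 <= r -> r <= t -> t < 1 ->
        hat r <= C * ((1 - r) / (1 - t)) `^ beta * hat t].
Proof.
move=> /Dhat_ge2[C C2 hC]; have C1 : 1 < C by lra.
have Cp : 0 < C by lra.
set b : R := ln C / ln 2.
have b0 : 0 < b by rewrite divr_gt0// ln_gt0// ltr1n.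
have Cb : 2 `^ b = C by apply: powR2_log2.
exists C, b; split; [exact: ltW|exact: b0|].
suff H k : forall r t, 0 <= r -> r <= t -> t < 1 -> 1 - r <= 2 ^+ k * (1 - t) ->
    hat r <= C * ((1 - r) / (1 - t)) `^ b * hat t.
  move=> r t r0 rt t1.
  have [k hk] : exists k : nat, 1 - r <= 2 ^+ k * (1 - t).
    have t10 : 0 < 1 - t by rewrite subr_gt0.
    exists (Num.truncn ((1 - t)^-1)).+1; rewrite -ler_pdivrMr//.
    have : (1 - t)^-1 <= 2 ^+ (Num.truncn (1 - t)^-1).+1.
      apply: le_trans (ltW (truncnS_gt _)) _.
      by rewrite -natrX ler_nat ltnW// ltn_expl.
    apply: le_trans; rewrite -[leRHS]mul1r ler_pM2r ?invr_gt0//; lra.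
  exact: H hk.
elim: k => [|k IH] r t r0 rt t1.
  rewrite expr0 mul1r => tr; have -> : r = t by lra.
  rewrite divff ?subr_eq0; last by rewrite eq_sym lt_eqF.
  by rewrite powR1 mulr1 ler_peMl ?hat_ge0// ltW.
move=> hk; have t10 : 0 < 1 - t by rewrite subr_gt0.
have q0 : 0 <= (1 - r) / (1 - t) by rewrite divr_ge0//; lra.
have [ht|ht] := leP t ((1 + r) / 2).
  have h1 : hat r <= C * hat t.
    apply: le_trans (hC r _) _; first by rewrite r0; lra.
    by rewrite ler_pM2l// hat_le.
  apply: (le_trans h1); rewrite ler_wpM2r ?hat_ge0// ler_peMr ?(ltW Cp)//.
  by apply: powR_ge1; rewrite ?(ltW b0)// ler_pdivlMr//; lra.
have h1 := hC r; have := IH ((1 + r) / 2) t.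
have -> : 1 - (1 + r) / 2 = (1 - r) / 2 by field.
move=> h2.
have {}h2 : hat ((1 + r) / 2) <= C * ((1 - r) / 2 / (1 - t)) `^ b * hat t.
  by apply: h2; rewrite ?(ltW ht)//; [lra|move: hk; rewrite exprS; lra].
have qE : C * ((1 - r) / 2 / (1 - t)) `^ b = ((1 - r) / (1 - t)) `^ b.
  rewrite -{1}Cb -powRM//; first by congr (_ `^ _); field; rewrite gt_eqF.
  by rewrite divr_ge0//; lra.
rewrite qE in h2; rewrite -mulrA.
apply: le_trans (h1 _) _; first by rewrite r0; lra.
by rewrite ler_pM2l.
Qed.

Lemma power_decay_Dhat :
  (exists C beta : R, [/\ 1 <= C, 0 < beta &
      forall r t : R, 0 <= r -> r <= t -> t < 1 ->
        hat r <= C * ((1 - r) / (1 - t)) `^ beta * hat t]) -> Dhat omega.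
Proof.
move=> [C [b [C1 b0 H]]]; exists (C * 2 `^ b).
  by rewrite mulr_gt0// ?powR_gt0//; lra.
move=> r /andP[r0 r1]; have := H r ((1 + r) / 2).
have -> : (1 - r) / (1 - (1 + r) / 2) = 2.
  by field; rewrite gt_eqF//; lra.
by apply=> //; lra.
Qed.

Lemma measurable_inv_itv (a b : R) : b <= 1 ->
  measurable_fun (`[a, b[ : set (measurableTypeR R)) (fun s => (1 - s)^-1).
Proof.
move=> b1.
apply: (eq_measurable_fun (fun s : measurableTypeR R => (1 - s) `^ (-1))).
  by move=> s; rewrite inE/= in_itv/= => /andP[_ sb]; rewrite powR_inv1//; lra.
apply: (@measurableT_comp _ _ _ _ _ _ (fun x : R => x `^ (-1))).
  exact: measurable_powR.
exact: measurable_funB.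
Qed.

Lemma measurable_ratio_powR (a b t g : R) : b <= 1 ->
  measurable_fun (`[a, b[ : set (measurableTypeR R))
    (fun s => ((1 - t) / (1 - s)) `^ g).
Proof.
move=> b1.
apply: (@measurableT_comp _ _ _ _ _ _ (fun x : R => x `^ g)).
  exact: measurable_powR.
by apply: measurable_funM => //; exact: measurable_inv_itv.
Qed.

(** With 2 ^ g = 2 C and u = 2 t - 1, the weight for t is 1 / (2 C) times the weight
for u, while hat omega (u) <= C hat omega (t).  The integral over [u, t) being at
most C hat omega (t) as well, the bound 2 C hat omega reproduces itself.
The exponent is at least 1, as the estimate of circle
integrals requires. *)
Lemma Dhat_ratio_integral : Dhat omega ->
  exists C gamma : R, [/\ 0 < C, 1 <= gamma &
    forall t : R, 0 <= t < 1 ->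
      (\int[omega]_(s in `[0%R, t[) (((1 - t) / (1 - s)) `^ gamma)%:E
        <= (C * hat t)%:E)%E].
Proof.
move=> /Dhat_ge2[C C2 hC].
have Cp : 0 < C by lra.
set g : R := ln (2 * C) / ln 2.
have l2 : 0 < ln 2 :> R by rewrite ln_gt0// ltr1n.
have g1 : 1 <= g.
  by rewrite /g ler_pdivlMr// mul1r ler_ln ?posrE//; lra.
have g0 : 0 <= g by lra.
have Cg : 2 `^ g = 2 * C by apply: powR2_log2; lra.
exists (2 * C), g; split => //; first by lra.
have small u t : 0 <= u <= t -> t < 1 -> 1 - u <= 2 * (1 - t) ->
    (\int[omega]_(s in `[u, t[) (((1 - t) / (1 - s)) `^ g)%:E
      <= (C * hat t)%:E)%E.
  move=> /andP[u0 ut] t1 ut2.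
  have h : hat u <= C * hat t.
    apply: le_trans (hC u _) _; first by rewrite u0; lra.
    by rewrite ler_pM2l// hat_le//; lra.
  apply: (@le_trans _ _ (1 * (hat u - hat t))%:E); last first.
    by rewrite lee_fin mul1r; have := hat_ge0 omega t; lra.
  apply: integral_itv_le => //; first exact: ltW.
  move=> s /andP[us st]; rewrite powR_ge0/= powR_le1// divr_ge0//; try lra.
  by rewrite ler_pdivrMr; lra.
suff H k : forall t, 0 <= t < 1 -> 1 <= 2 ^+ k * (1 - t) ->
    (\int[omega]_(s in `[0%R, t[) (((1 - t) / (1 - s)) `^ g)%:E
      <= (2 * C * hat t)%:E)%E.
  move=> t /andP[t0 t1]; have t10 : 0 < 1 - t by rewrite subr_gt0.
  apply: (H (Num.truncn ((1 - t)^-1)).+1); first by rewrite t0.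
  rewrite -ler_pdivrMr// div1r; apply: le_trans (ltW (truncnS_gt _)) _.
  by rewrite -natrX ler_nat ltnW// ltn_expl.
elim: k => [|k IH] t /andP[t0 t1] hk.
  rewrite (_ : t = 0) in t1 *; last by move: hk; rewrite expr0 mul1r; lra.
  apply: le_trans (small 0 0 _ _ _) _; rewrite ?lexx//; first by lra.
  by rewrite lee_fin ler_wpM2r ?hat_ge0//; lra.
have [t2|t2] := leP t (1 / 2).
  apply: le_trans (small 0 t _ _ _) _; rewrite ?lexx//; first by lra.
  by rewrite lee_fin ler_wpM2r ?hat_ge0//; lra.
pose u := 2 * t - 1.
have u0 : 0 <= u by rewrite /u; lra.
have ut : u <= t by rewrite /u; lra.
have ue : 1 - u = 2 * (1 - t) by rewrite /u; lra.
rewrite (@integral_itv_split _ _ _ u)//; first last.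
- by move=> x _; exact: powR_ge0.
- by apply: measurable_ratio_powR; exact: ltW.
have -> : 2 * C * hat t = (2 * C)^-1 * (2 * C * (C * hat t)) + C * hat t.
  by field; rewrite gt_eqF.
rewrite EFinD; apply: leeD; last by apply: small; rewrite ?u0// ue.
have -> : (\int[omega]_(s in `[0%R, u[) (((1 - t) / (1 - s)) `^ g)%:E =
  \int[omega]_(s in `[0%R, u[) ((2 * C)^-1 * ((1 - u) / (1 - s)) `^ g)%:E)%E.
  apply: eq_integral => s; rewrite inE/= in_itv/= => /andP[s0 su].
  congr (_%:E); have -> : (1 - t) / (1 - s) = 2^-1 * ((1 - u) / (1 - s)).
    by rewrite ue; field; rewrite gt_eqF//; lra.
  rewrite powRM ?invr_ge0//; last by rewrite divr_ge0//; lra.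
  by rewrite -Cg -powRN -(powR_inv1 (ler0n _ _)) -powRrM mulN1r.
have C20 : 0 <= (2 * C)^-1 by rewrite invr_ge0; lra.
rewrite integral_itvZ//; last first.
- by move=> x _; exact: powR_ge0.
- by apply: measurable_ratio_powR; lra.
rewrite EFinM lee_wpmul2l//.
apply: (@le_trans _ _ (2 * C * hat u)%:E).
  by apply: IH; [rewrite u0; lra|move: hk; rewrite exprS ue; lra].
rewrite lee_fin ler_pM2l//; last by lra.
have := hC u; have -> : (1 + u) / 2 = t by rewrite /u; field.
by apply; rewrite u0; lra.
Qed.

(** With u = (1 - s) / (1 - t), the weight s ^ (1 / (1 - t)) is at most e ^ -u, and
e ^ -u <= g ^ g u ^ -g.  The comparison of the masses of [0, 1) and [1/2, 1) is
the case t = 1/2, where the weight is bounded below on [0, 1/2). *)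
Lemma ratio_integral_power_integral :
  (exists C gamma : R, [/\ 0 < C, 0 < gamma &
    forall t : R, 0 <= t < 1 ->
      (\int[omega]_(s in `[0%R, t[) (((1 - t) / (1 - s)) `^ gamma)%:E
        <= (C * hat t)%:E)%E]) ->
  exists C0 C : R, [/\ 0 < C0, 0 < C,
    hat 0 <= C0 * hat (1 / 2) &
    forall t : R, 0 <= t < 1 ->
      (\int[omega]_(s in `[0%R, t[) (s `^ (1 / (1 - t)))%:E
        <= (C * hat t)%:E)%E].
Proof.
move=> [C [g [C0 g0 H]]].
have gg : 0 < g `^ g by rewrite powR_gt0.
have k0 : 0 < (1 / 2) `^ g :> R by rewrite powR_gt0//; lra.
exists (C / (1 / 2) `^ g + 1), (g `^ g * C); split.
- by rewrite addr_gt0// divr_gt0.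
- by rewrite mulr_gt0.
- have h1 : (((1 / 2) `^ g * (hat 0 - hat (1 / 2)))%:E <= (C * hat (1 / 2))%:E)%E.
    apply: le_trans (H (1 / 2) _); last by lra.
    apply: integral_itv_ge; try lra.
      by move=> x _; exact: powR_ge0.
    move=> s /andP[s0 s2]; apply: powR_le_base; try lra.
    by rewrite ler_pdivlMr; nra.
  rewrite lee_fin -ler_pdivlMl// in h1.
  have -> : (C / (1 / 2) `^ g + 1) * hat (1 / 2) =
    ((1 / 2) `^ g)^-1 * (C * hat (1 / 2)) + hat (1 / 2) by ring.
  by rewrite -lerBlDr.
- move=> t /andP[t0 t1]; have t10 : 0 < 1 - t by rewrite subr_gt0.
  apply: (@le_trans _ _ (\int[omega]_(s in `[0%R, t[)
      (g `^ g * ((1 - t) / (1 - s)) `^ g)%:E)%E).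
    apply: integral_itv_mono => s /andP[s0 st]; rewrite powR_ge0/=.
    apply: le_trans (powR_le_expRN s0 _) _; first by rewrite div1r invr_gt0.
    rewrite expRN.
    set u := 1 / (1 - t) * (1 - s).
    have u0 : 0 < u by rewrite mulr_gt0// ?divr_gt0//; lra.
    have -> : (1 - t) / (1 - s) = u^-1.
      by rewrite /u; field; rewrite gt_eqF//= gt_eqF//; lra.
    have := powR_le_expR g0 u0.
    have ug : 0 < u `^ g by rewrite powR_gt0.
    rewrite -(powR_inv1 (ltW u0)) -powRrM mulN1r powRN.
    by rewrite ler_pdivlMr// ler_pdivrMl ?expR_gt0// [expR u * _]mulrC.
  rewrite integral_itvZ ?(ltW gg)//; last first.
  - by move=> x _; exact: powR_ge0.
  - by apply: measurable_ratio_powR; exact: ltW.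
  rewrite -[_ * C * _]mulrA EFinM. apply: lee_wpmul2l; last by apply: H; rewrite t0.
  by rewrite lee_fin ltW.
Qed.

(** The mass of [r, t) costs at least r ^ (1 / (1 - t)) in the integral. *)
Lemma power_integral_power_decay :
  (exists C0 C : R, [/\ 0 < C0, 0 < C,
    hat 0 <= C0 * hat (1 / 2) &
    forall t : R, 0 <= t < 1 ->
      (\int[omega]_(s in `[0%R, t[) (s `^ (1 / (1 - t)))%:E
        <= (C * hat t)%:E)%E]) ->
  exists C0 C : R, [/\ 0 < C0, 0 < C,
    hat 0 <= C0 * hat (1 / 2) &
    forall r t : R, 0 < r -> r <= t -> t < 1 ->
      hat r <= C * r `^ (- (1 / (1 - t))) * hat t].
Proof.
move=> [C0 [C [C00 Cp h0 H]]]; exists C0, (C + 1); split => //; first by lra.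
move=> r t r0 rt t1; set x := 1 / (1 - t).
have x0 : 0 < x by rewrite divr_gt0//; lra.
have rx : 0 < r `^ x by rewrite powR_gt0.
have x0' := ltW x0; have r0' := ltW r0.
have h1 : ((r `^ x * (hat r - hat t))%:E <= (C * hat t)%:E)%E.
  apply: le_trans (H t _); last by lra.
  apply: integral_itv_ge; try lra.
    by move=> s _; exact: powR_ge0.
  by move=> s /andP[rs _]; exact: powR_le_base.
rewrite lee_fin -ler_pdivlMl// in h1.
rewrite powRN.
have rx1 : 1 <= (r `^ x)^-1.
  by rewrite invf_ge1// powR_le1 ?r0'//; lra.
have := hat_ge0 omega t; move: h1.
set A := _^-1 in rx1 *; move=> h1 h2.
have : 0 <= (A - 1) * hat t by rewrite mulr_ge0//; lra.
lra.
Qed.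

(** At t = (1 + r) / 2 the exponent is 2 / (1 - r), and r ^ (2 / (1 - r)) >= e ^ -4
for r >= 1/2. *)
Lemma base_power_decay_Dhat :
  (exists C0 C : R, [/\ 0 < C0, 0 < C,
    hat 0 <= C0 * hat (1 / 2) &
    forall r t : R, 0 < r -> r <= t -> t < 1 ->
      hat r <= C * r `^ (- (1 / (1 - t))) * hat t]) -> Dhat omega.
Proof.
move=> [C0 [C [C00 Cp h0 H]]].
apply: (@Dhat_of_upper_half C0 (C * expR 4)) => //.
  by rewrite mulr_gt0// expR_gt0.
move=> r /andP[r2 r1].
apply: le_trans (H r ((1 + r) / 2) _ _ _) _; try lra.
rewrite ler_wpM2r ?hat_ge0// ler_pM2l// powRN.
rewrite -[leRHS]invrK -expRN lef_pV2 ?posrE ?expR_gt0 ?powR_gt0//; last by lra.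
have -> : - 4 = - (2 * (1 / (1 - (1 + r) / 2)) * (1 - r)) :> R.
  by field; rewrite gt_eqF//; lra.
by apply: expRN_le_powR; [lra|rewrite divr_ge0//; lra].
Qed.
End TailConditions.

(** * Moments *)

Section Moments.
Context (R : realType) (omega : {finite_measure set (measurableTypeR R) -> \bar R}).
Local Notation hat := (hat omega).

Lemma measurable_powR_itv (a b x : R) :
  measurable_fun (`[a, b[ : set (measurableTypeR R)) (fun s => s `^ x).
Proof. by apply: measurable_funTS; exact: measurable_powR. Qed.

Lemma moment_split (t x : R) : 0 <= t <= 1 ->
  (moment omega x = \int[omega]_(s in `[0%R, t[) (s `^ x)%:E +
                    \int[omega]_(s in `[t, 1%R[) (s `^ x)%:E)%E.
Proof.
move=> /andP[t0 t1]; apply: integral_itv_split => //.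
- exact: measurable_powR_itv.
- by move=> s _; exact: powR_ge0.
Qed.

Lemma moment_ge_head (t x : R) : 0 <= t <= 1 ->
  (\int[omega]_(s in `[0%R, t[) (s `^ x)%:E <= moment omega x)%E.
Proof.
move=> t01; rewrite (moment_split _ t01) leeDl//.
by apply: integral_ge0 => s _; rewrite lee_fin powR_ge0.
Qed.

Lemma moment_le_hat0 (x : R) : 0 <= x -> (moment omega x <= (hat 0)%:E)%E.
Proof.
move=> x0; apply: (@le_trans _ _ (1 * (hat 0 - hat 1))%:E).
  apply: integral_itv_le => // s /andP[s0 s1]; rewrite powR_ge0/=.
  by apply: powR_le1 => //; rewrite s0 ltW.
by rewrite hat1 mul1r subr0.
Qed.

Lemma moment_ge0 (x : R) : (0 <= moment omega x)%E.
Proof. by apply: integral_ge0 => s _; rewrite lee_fin powR_ge0. Qed.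

Lemma moment_fin_num (x : R) : 0 <= x -> moment omega x \is a fin_num.
Proof.
move=> x0; rewrite ge0_fin_numE ?moment_ge0//.
by apply: le_lt_trans (moment_le_hat0 x0) _; rewrite ltry.
Qed.

Lemma moment_antimono (x y : R) : 0 < x -> x <= y ->
  (moment omega y <= moment omega x)%E.
Proof.
move=> x0 xy; apply: integral_itv_mono => s /andP[s0 s1]; rewrite powR_ge0/=.
move: s0; rewrite le_eqVlt => /predU1P[<-|s0].
  by rewrite !powR0// gt_eqF//; lra.
by apply: ger_powR => //; rewrite s0 ltW.
Qed.

(** Used with x (1 - a) bounded, when the exponential stays away from 0. *)
Lemma moment_ge_hat (a x : R) : 1 / 2 <= a <= 1 -> 0 <= x ->
  ((expR (- (2 * x * (1 - a))) * hat a)%:E <= moment omega x)%E.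
Proof.
move=> /andP[a2 a1] x0.
have -> : hat a = hat a - hat 1 by rewrite hat1 subr0.
apply: integral_itv_ge => //; try lra.
- by move=> s _; exact: powR_ge0.
- move=> s /andP[as_ s1].
  apply: le_trans (expRN_le_powR _ x0); last by rewrite (le_trans a2)// ltW.
  by rewrite ler_expR; nra.
Qed.

(** The upper bound splits the moment at t = 1 - 1 / x, the lower one restricts it to
[max(t, 1/2), 1), where 2 x (1 - s) <= 2. *)
Lemma power_integral_moment_asymp :
  (exists C0 C : R, [/\ 0 < C0, 0 < C,
    hat 0 <= C0 * hat (1 / 2) &
    forall t : R, 0 <= t < 1 ->
      (\int[omega]_(s in `[0%R, t[) (s `^ (1 / (1 - t)))%:E
        <= (C * hat t)%:E)%E]) ->
  asymp_on [set x : R | 1 <= x]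
      (fun x => moment omega x) (fun x => (hat (1 - 1 / x))%:E).
Proof.
move=> [C0 [C [C00 Cp h0 H]]].
have e0 : 0 < expR (- 2 : R) by exact: expR_gt0.
exists (expR (- 2) / (C0 + 1)), (C + 1); split.
- by rewrite divr_gt0// addr_gt0.
- by rewrite addr_gt0.
move=> x /= x1; have x0 : 0 < x by lra.
have xV : 0 < 1 / x <= 1.
  by rewrite divr_gt0//= ler_pdivrMr// mul1r.
set t := 1 - 1 / x; have t0 : 0 <= t by rewrite /t; lra.
have t1 : t < 1 by rewrite /t; lra.
have te : 1 - t = x^-1 by rewrite /t subKr div1r.
have tx : 1 / (1 - t) = x by rewrite te div1r invrK.
have xt : x * (1 - t) = 1 by rewrite te mulfV ?gt_eqF.
rewrite -!EFinM; split; last first.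
  rewrite (@moment_split t) ?t0 ?(ltW t1)//.
  rewrite mulrDl EFinD; apply: leeD.
    by rewrite -{1}tx; apply: H; rewrite t0.
  rewrite -[hat t](subr0) -(hat1 omega); apply: integral_itv_le => //.
    exact: ltW.
  move=> s /andP[ts s1]; rewrite powR_ge0/=; apply: powR_le1; last lra.
  by rewrite (le_trans t0)//= ltW.
have [t2|t2] := leP (1 / 2) t.
  apply: le_trans (@moment_ge_hat t x _ _); [|by rewrite t2/= ltW|exact: ltW].
  rewrite lee_fin ler_wpM2r ?hat_ge0// -mulrA xt mulr1.
  by rewrite ler_pdivrMr ?ler_peMr ?(ltW e0)//; lra.
apply: le_trans (@moment_ge_hat (1 / 2) x _ _); [|by apply/andP; lra|exact: ltW].
have x2 : x <= 2 by nra.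
have h1 : hat t <= C0 * hat (1 / 2) by apply: le_trans h0; exact: hat_le.
have h2 : expR (- 2) <= expR (- (2 * x * (1 - 1 / 2))) by rewrite ler_expR; lra.
rewrite lee_fin mulrAC ler_pdivrMr; last by lra.
apply: (@le_trans _ _ (expR (- 2) * (C0 * hat (1 / 2)))); first by rewrite ler_pM2l.
have hh := hat_ge0 omega (1 / 2).
rewrite -[_ * hat (1 / 2) * _]mulrA; apply: ler_pM => //.
  by rewrite mulr_ge0// ltW.
by lra.
Qed.

(** The integral over [0, t) is at most the moment of order x = 1 / (1 - t). *)
Lemma moment_asymp_power_integral :
  (exists2 C0 : R, 0 < C0 & hat 0 <= C0 * hat (1 / 2)) ->
  asymp_on [set x : R | 1 <= x]
      (fun x => moment omega x) (fun x => (hat (1 - 1 / x))%:E) ->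
  exists C0 C : R, [/\ 0 < C0, 0 < C,
    hat 0 <= C0 * hat (1 / 2) &
    forall t : R, 0 <= t < 1 ->
      (\int[omega]_(s in `[0%R, t[) (s `^ (1 / (1 - t)))%:E
        <= (C * hat t)%:E)%E].
Proof.
move=> [C0 C00 h0] [c [C [c0 Cp H]]]; exists C0, C; split => //.
move=> t /andP[t0 t1].
have [|_] := H (1 / (1 - t)).
  by rewrite /= ler_pdivlMr; lra.
have -> : 1 - 1 / (1 / (1 - t)) = t by rewrite !div1r invrK subKr.
by rewrite -EFinM; apply: le_trans; apply: moment_ge_head; rewrite t0 ltW.
Qed.

(** For x >= 1 this is the power bound for the tail at 1 - 1 / x and 1 - 1 / y, as
(1/x) / (1/y) = y / x.  Orders below 1 behave like the order 1, since all those
moments lie between the first moment and the total mass. *)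
Lemma moment_growth_of_asymp :
  (exists C beta : R, [/\ 1 <= C, 0 < beta &
      forall r t : R, 0 <= r -> r <= t -> t < 1 ->
        hat r <= C * ((1 - r) / (1 - t)) `^ beta * hat t]) ->
  asymp_on [set x : R | 1 <= x]
      (fun x => moment omega x) (fun x => (hat (1 - 1 / x))%:E) ->
  exists C eta : R, [/\ 0 < C, 0 < eta &
    forall x y : R, 0 < x -> x <= y ->
      (moment omega x <= (C * (y / x) `^ eta)%:E * moment omega y)%E].
Proof.
move=> [C2 [b [C21 b0 H]]] [c [C1 [c0 C10 M]]].
have D0 : 0 < (C1 + 1) * C2 by rewrite mulr_gt0//; lra.
exists ((C1 + 1) * C2 / c), b; split => //; first by rewrite divr_gt0.
move=> x y x0 xy; have y0 : 0 < y by lra.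
(* replacing the orders by their maximum with 1 does not increase their ratio *)
pose X := Num.max x 1; pose Y := Num.max y 1.
have X1 : 1 <= X by rewrite /X le_max lexx orbT.
have Y1 : 1 <= Y by rewrite /Y le_max lexx orbT.
have XY : X <= Y by rewrite /X ge_max !le_max xy lexx orbT.
have Yp : 0 < Y by lra.
have Xp : 0 < X by lra.
have YXyx : Y / X <= y / x.
  rewrite ler_pdivlMr// mulrAC ler_pdivrMr// /X /Y.
  by case: (leP x 1) => x1; case: (leP y 1) => y1; nra.
have hX : (moment omega x <= ((C1 + 1) * hat (1 - 1 / X))%:E)%E.
  have h := hat_ge0 omega (1 - 1 / X).
  have [x1|x1] := leP 1 x.
    have XE : X = x by rewrite /X; apply/max_idPl.
    rewrite XE in h *; have [_ h1] := M x x1; apply: (le_trans h1).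
    by rewrite -EFinM lee_fin mulrDl lerDl mul1r.
  have XE : X = 1 by rewrite /X; apply/max_idPr; exact: ltW.
  rewrite XE divr1 subrr in h *.
  apply: le_trans (moment_le_hat0 _) _; first exact: ltW.
  by rewrite lee_fin mulrDl mul1r lerDr mulr_ge0// ltW.
have hY : ((c * hat (1 - 1 / Y))%:E <= moment omega y)%E.
  have [y1|y1] := leP 1 y.
    have -> : Y = y by rewrite /Y; apply/max_idPl.
    by have [] := M y y1.
  have -> : Y = 1 by rewrite /Y; apply/max_idPr; exact: ltW.
  have [h1 _] := M 1 (lexx _); rewrite -EFinM in h1; apply: (le_trans h1).
  exact: moment_antimono (ltW y1).
have hXY : hat (1 - 1 / X) <= C2 * (Y / X) `^ b * hat (1 - 1 / Y).
  have := H (1 - 1 / X) (1 - 1 / Y).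
  have -> : (1 - (1 - 1 / X)) / (1 - (1 - 1 / Y)) = Y / X.
    by rewrite !subKr !div1r invrK mulrC.
  apply.
  - by rewrite subr_ge0 ler_pdivrMr// mul1r.
  - by rewrite lerD2l lerN2 !div1r lef_pV2.
  - by rewrite ltrBlDr ltrDl divr_gt0.
have yx0 : 0 <= (C1 + 1) * C2 / c * (y / x) `^ b.
  by rewrite mulr_ge0 ?powR_ge0// divr_ge0// ltW.
apply: le_trans (lee_wpmul2l _ hY); last by rewrite lee_fin.
apply: (le_trans hX); rewrite -EFinM lee_fin.
have -> : (C1 + 1) * C2 / c * (y / x) `^ b * (c * hat (1 - 1 / Y)) =
  (C1 + 1) * (C2 * (y / x) `^ b * hat (1 - 1 / Y)).
  by field; rewrite gt_eqF.
rewrite ler_pM2l; last by lra.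
apply: (le_trans hXY); rewrite ler_wpM2r ?hat_ge0// ler_pM2l; last by lra.
by apply: powR_le_base => //; rewrite ?divr_ge0// ltW.
Qed.

Lemma moment_growth_doubling :
  (exists C eta : R, [/\ 0 < C, 0 < eta &
    forall x y : R, 0 < x -> x <= y ->
      (moment omega x <= (C * (y / x) `^ eta)%:E * moment omega y)%E]) ->
  exists2 C : R, 0 < C & forall n : nat, (0 < n)%N ->
       (moment omega n%:R <= C%:E * moment omega (2 * n)%:R)%E.
Proof.
move=> [C [e [C0 e0 H]]]; exists (C * 2 `^ e).
  by rewrite mulr_gt0// powR_gt0.
move=> n n0; have n0' : 0 < n%:R :> R by rewrite ltr0n.
have := H n%:R (2 * n)%:R n0'.
have -> : (2 * n)%:R / n%:R = 2 :> R by rewrite natrM mulfK// gt_eqF.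
by apply; rewrite ler_nat leq_pmull.
Qed.

(** Let N = 2 ^ k n and t = 1 - 1 / n.  Splitting at t,
omega_N <= t ^ (N - n) omega_n + hat omega (t), where
t ^ (N - n) <= e ^ - (2 ^ k - 1) and omega_n <= C ^ k omega_N.  For k large the
first term is at most omega_N / 2 and is absorbed. *)
Lemma moment_doubling_le_hat :
  (exists2 C : R, 0 < C & forall n : nat, (0 < n)%N ->
       (moment omega n%:R <= C%:E * moment omega (2 * n)%:R)%E) ->
  exists2 A : R, 0 < A & forall n : nat, (0 < n)%N ->
    (moment omega n%:R <= (A * hat (1 - n%:R^-1))%:E)%E.
Proof.
move=> [C C0 H].
have [k kL] := exists_pow2_ge (ln C).
exists (2 * C ^+ k); first by rewrite mulr_gt0// exprn_gt0.
move=> n n0; have n0' : 0 < n%:R :> R by rewrite ltr0n.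
have iter j : (moment omega n%:R <= (C ^+ j)%:E * moment omega (2 ^ j * n)%:R)%E.
  elim: j => [|j IH]; first by rewrite expr0 expn0 mul1n mul1e.
  apply: (le_trans IH); rewrite exprSr EFinM -muleA.
  apply: lee_wpmul2l; first by rewrite lee_fin exprn_ge0// ltW.
  by rewrite expnS -mulnA; apply: H; rewrite muln_gt0 expn_gt0.
have [N NE] : exists N, N = (2 ^ k * n)%N by eexists.
have nN : (n <= N)%N by rewrite NE leq_pmull// expn_gt0.
pose t : R := 1 - n%:R^-1.
have nV : 0 < (n%:R^-1 : R) <= 1 by rewrite invr_gt0 n0' invf_le1// ler1n.
have t0 : 0 <= t by rewrite /t; lra.
have t1 : t <= 1 by rewrite /t; lra.
pose d : R := (N - n)%:R.
have dE : N%:R = d + n%:R by rewrite /d -natrD subnK.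
have d0 : 0 <= d by exact: ler0n.
have tail : (\int[omega]_(s in `[t, 1%R[) (s `^ N%:R)%:E <= (hat t)%:E)%E.
  rewrite -[hat t](mul1r) -[hat t](subr0) -(hat1 omega).
  apply: integral_itv_le => // s /andP[ts s1].
  by rewrite powR_ge0/= powR_le1 ?ler0n// (le_trans t0)//= ltW.
have head : (\int[omega]_(s in `[0%R, t[) (s `^ N%:R)%:E <=
    (t `^ d)%:E * moment omega n%:R)%E.
  apply: (@le_trans _ _ ((t `^ d)%:E * \int[omega]_(s in `[0%R, t[) (s `^ n%:R)%:E)%E);
    last first.
    by apply: lee_wpmul2l; rewrite ?lee_fin ?powR_ge0// moment_ge_head// t0.
  rewrite -integral_itvZ ?powR_ge0//; first last.
  - by move=> s _; exact: powR_ge0.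
  - exact: measurable_powR_itv.
  apply: integral_itv_mono => s /andP[s0 st]; rewrite powR_ge0/= dE powRD.
    by rewrite ler_wpM2r ?powR_ge0// powR_le_base// ltW.
  by rewrite gt_eqF//; lra.
have td : t `^ d <= expR (- (2 ^+ k - 1)).
  (* d = 0 happens for k = 0, when both sides are 1 *)
  have [dz|dn] := eqVneq d 0.
    have Nn : N = n by apply/eqP; move/eqP: dz; rewrite pnatr_eq0 subn_eq0 eqn_leq nN andbT.
    have -> : 2 ^+ k = 1 :> R.
      move: Nn; rewrite NE -[RHS]mul1n => /eqP; rewrite eqn_pmul2r// => /eqP h.
      by rewrite -natrX h.
    by rewrite dz powRr0 subrr oppr0 expR0.
  apply: le_trans (powR_le_expRN _ _) _ => //; first by rewrite lt_neqAle eq_sym dn.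
  rewrite ler_expR lerN2 /t subKr /d natrB// NE natrM natrX.
  by rewrite mulrBl mulfK ?gt_eqF// divff ?gt_eqF.
have half : expR (- (2 ^+ k - 1)) * C ^+ k <= 1 / 2.
  have -> : C ^+ k = expR (k%:R * ln C) by rewrite expRM_natl lnK.
  rewrite -expRD; apply: (@le_trans _ _ (expR (- 1))); first by rewrite ler_expR; lra.
  rewrite expRN div1r lef_pV2 ?posrE ?expR_gt0//.
  exact: (expR_ge1Dx (1 : R)).
have [A AE] : exists A, moment omega N%:R = A%:E.
  by exists (fine (moment omega N%:R)); rewrite fineK// moment_fin_num.
have [B BE] : exists B, moment omega n%:R = B%:E.
  by exists (fine (moment omega n%:R)); rewrite fineK// moment_fin_num.
have A0 : 0 <= A by rewrite -lee_fin -AE moment_ge0.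
have B0 : 0 <= B by rewrite -lee_fin -BE moment_ge0.
have hA : A <= t `^ d * B + hat t.
  rewrite -lee_fin -AE (@moment_split t) ?t0// EFinD EFinM -BE.
  exact: leeD.
have hB : B <= C ^+ k * A.
  by have := iter k; rewrite -NE AE BE -EFinM lee_fin.
rewrite BE lee_fin -/t.
have ht := hat_ge0 omega t; have Ck : 0 < C ^+ k by rewrite exprn_gt0.
move: (hat t) ht hA => {H iter head tail AE BE} y ht hA.
have h1 : t `^ d * B <= A / 2.
  apply: (@le_trans _ _ (expR (- (2 ^+ k - 1)) * (C ^+ k * A))).
    apply: ler_pM => //; exact: powR_ge0.
  by rewrite mulrA; have := ler_wpM2r A0 half; lra.
have : C ^+ k * A <= C ^+ k * (2 * y) by rewrite ler_pM2l//; lra.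
by lra.
Qed.

(** Choose n just above 2 / (1 - r): then 1 - 1 / n >= (1 + r) / 2, and n (1 - r) <= 3
keeps r ^ n above e ^ -6. *)
Lemma moment_doubling_Dhat :
  (exists2 C0 : R, 0 < C0 & hat 0 <= C0 * hat (1 / 2)) ->
  (exists2 C : R, 0 < C & forall n : nat, (0 < n)%N ->
       (moment omega n%:R <= C%:E * moment omega (2 * n)%:R)%E) -> Dhat omega.
Proof.
move=> [C0 C00 h0] /moment_doubling_le_hat[A A0 HA].
apply: (@Dhat_of_upper_half _ _ C0 (expR 6 * A)) => //.
  by rewrite mulr_gt0// expR_gt0.
move=> r /andP[r2 r1]; have r10 : 0 < 1 - r by lra.
pose n := (Num.truncn (2 / (1 - r))).+1.
have n0 : 0 < n%:R :> R by rewrite ltr0n.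
have n1 : 2 <= n%:R * (1 - r).
  by rewrite -ler_pdivrMr// ltW// truncnS_gt.
have n2 : n%:R * (1 - r) <= 3.
  have : n%:R <= 2 / (1 - r) + 1 by rewrite /n -natr1 lerD2r truncn_le// divr_ge0// ltW.
  by rewrite -(ler_pM2r r10) mulrDl divfK ?gt_eqF//; lra.
have := HA n isT.
have /le_trans : ((expR (- 6) * hat r)%:E <= moment omega n%:R)%E.
  apply: le_trans (@moment_ge_hat r n%:R _ _) => //; last by apply/andP; lra.
  by rewrite lee_fin ler_wpM2r ?hat_ge0// ler_expR; lra.
move=> /[apply]; rewrite lee_fin expRN ler_pdivrMl ?expR_gt0// mulrA.
move=> /le_trans; apply; rewrite ler_wpM2l ?mulr_ge0 ?expR_ge0 ?(ltW A0)//.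
apply: hat_le; have : n%:R^-1 <= (1 - r) / 2.
  by rewrite -[leLHS]mul1r ler_pdivrMr//; lra.
by lra.
Qed.
End Moments.

(** * Complex numbers in polar form *)

Section Modulus.
Context (R : realType).

Lemma cmod_real (r : R) : 0 <= r -> cmod (Complex r 0) = r.
Proof. by move=> r0; rewrite /= expr0n/= addr0 sqrtr_sqr ger0_norm. Qed.

Lemma cmod_ge0 (z : R[i]) : 0 <= cmod z.
Proof. by case: z => x y; exact: sqrtr_ge0. Qed.

(** The argument is acos (x / |z|), with the sign of y. *)
Lemma polar_form (z : R[i]) : exists2 phi, - pi <= phi <= pi &
  z = Complex (cmod z * cos phi) (cmod z * sin phi).
Proof.
case: z => x y; set m := cmod _.
have p0 := @pi_gt0 R.
have m2 : m ^+ 2 = x ^+ 2 + y ^+ 2 by rewrite sqr_sqrtr// addr_ge0 ?sqr_ge0.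
have [mz|mn] := eqVneq m 0.
  exists 0; first by lra.
  have : x ^+ 2 + y ^+ 2 == 0 by rewrite -m2 mz expr0n.
  by rewrite paddr_eq0 ?sqr_ge0// !sqrf_eq0 mz !mul0r => /andP[/eqP-> /eqP->].
have m0 : 0 < m by rewrite lt_neqAle eq_sym mn cmod_ge0.
have s1 : y ^+ 2 / m ^+ 2 = 1 - (x / m) ^+ 2.
  by rewrite expr_div_n m2; field; rewrite -m2 expf_neq0.
have xm : -1 <= x / m <= 1.
  rewrite -ler_norml -(@ler_pXn2r _ 2) ?nnegrE// real_normK ?num_real// expr1n.
  by rewrite -subr_ge0 -s1 divr_ge0 ?sqr_ge0.
have cx : cos (acos (x / m)) = x / m by apply: acosK; rewrite in_itv.
have sx : sin (acos (x / m)) = `|y| / m.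
  rewrite sin_acos// -s1 -expr_div_n sqrtr_sqr normrM normfV.
  by rewrite (gtr0_norm m0).
have a0 := acos_ge0 xm; have ap := acos_lepi xm.
have [y0|y0] := leP 0 y.
  exists (acos (x / m)); first by lra.
  by rewrite cx sx ger0_norm// ![m * _]mulrC !divfK.
exists (- acos (x / m)); first by lra.
by rewrite cosN sinN cx sx ltr0_norm// -mulNr opprK ![m * _]mulrC !divfK.
Qed.

End Modulus.

(** * The associated weight omega-star *)

Section Star.
Context (R : realType) (omega : {finite_measure set (measurableTypeR R) -> \bar R}).
Local Notation hat := (hat omega).

(** Iterating a contraction of 1 - r by any factor q < 1 reaches one half. *)
Lemma Dhat_of_contraction (C0 K q : R) : 0 < C0 -> 0 < K -> 0 < q < 1 ->
  hat 0 <= C0 * hat (1 / 2) ->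
  (forall r, 1 / 2 <= r < 1 -> hat r <= K * hat (1 - q * (1 - r))) -> Dhat omega.
Proof.
move=> C00 K0 /andP[q0 q1] h0 H.
have iter k : forall r, 1 / 2 <= r < 1 -> hat r <= K ^+ k * hat (1 - q ^+ k * (1 - r)).
  elim: k => [|k IH] r /andP[r2 r1].
    by rewrite !expr0 !mul1r subKr.
  apply: le_trans (H r _) _; first by rewrite r2.
  have := IH (1 - q * (1 - r)); rewrite subKr.
  have -> : q ^+ k * (q * (1 - r)) = q ^+ k.+1 * (1 - r) by rewrite exprSr mulrA.
  by rewrite [K ^+ k.+1]exprS -[K * _ * _]mulrA ler_pM2l//; apply; nra.
have [k hk] : exists k : nat, 2 < q^-1 ^+ k.
  by apply: exists_expr_gt; rewrite invf_gt1.
apply: (@Dhat_of_upper_half _ _ C0 (K ^+ k)) => //; first by rewrite exprn_gt0.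
move=> r r01; apply: le_trans (iter k r r01) _.
have qk : 0 < q ^+ k by rewrite exprn_gt0.
rewrite ler_pM2l ?exprn_gt0//; apply: hat_le.
have : q ^+ k <= 1 / 2.
  by rewrite div1r -[leLHS]invrK lef_pV2 ?posrE ?invr_gt0// -exprVn ltW.
by case/andP: r01 => _ r1; nra.
Qed.

Lemma measurable_ln_ratio (r a b : R) :
  measurable_fun (`[a, b[ : set (measurableTypeR R)) (fun s => ln (s / r) * s).
Proof.
apply: measurable_funM => //; apply: measurable_funTS.
apply: (@measurableT_comp _ _ _ _ _ _ (@ln R)); first exact: measurable_ln.
exact: measurable_funM.
Qed.

Lemma star_piece_le (r a b : R) : 1 / 2 <= r -> r <= a -> a <= b -> b <= 1 ->
  (\int[omega]_(s in `[a, b[) (ln (s / r) * s)%:E <=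
    (2 * (b - r) * (hat a - hat b))%:E)%E.
Proof.
move=> r2 ra ab b1; apply: integral_itv_le => // s /andP[as_ sb].
have /andP[h1 h2] := @ln_ratio_bounds R r s r2 ltac:(lra) ltac:(lra).
by apply/andP; split; [apply: le_trans h1|apply: (le_trans h2)]; lra.
Qed.

Lemma star_ge (r a : R) : 1 / 2 <= r -> r <= a -> a <= 1 ->
  (((a - r) * hat a)%:E <= \int[omega]_(s in `[r, 1%R[) (ln (s / r) * s)%:E)%E.
Proof.
move=> r2 ra a1; rewrite -[hat a](subr0) -(hat1 omega).
apply: integral_itv_ge => //; try lra.
- move=> s /andP[rs s1].
  have /andP[h1 _] := @ln_ratio_bounds R r s r2 rs (ltW s1).
  by apply: le_trans h1; lra.
- move=> s /andP[as_ s1].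
  have /andP[h1 _] := @ln_ratio_bounds R r s r2 ltac:(lra) (ltW s1).
  by apply: le_trans h1; lra.
Qed.

(** Keeping only [(1 + r) / 2, 1), where s - r >= (1 - r) / 2, gives the lower bound. *)
Lemma Dhat_star_asymp : Dhat omega ->
  asymp_on [set z : R[i] | 1 / 2 <= cmod z < 1]
      (fun z => omega_star omega z)
      (fun z => (hat (cmod z) * (1 - cmod z))%:E).
Proof.
move=> [C C0 HC]; exists (1 / (2 * C)), 2; split => //.
  by rewrite divr_gt0// mulr_gt0.
move=> z /=; rewrite /omega_star; move: (cmod z) => r /andP[r2 r1].
have h := hat_ge0 omega r; rewrite -!EFinM; split.
  apply: le_trans (@star_ge r ((1 + r) / 2) r2 ltac:(lra) ltac:(lra)).
  rewrite lee_fin mulrC mul1r ler_pdivrMr; last by rewrite mulr_gt0.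
  have -> : ((1 + r) / 2 - r) * hat ((1 + r) / 2) * (2 * C) =
    (C * hat ((1 + r) / 2)) * (1 - r) by field.
  rewrite ler_pM2r; last by lra.
  by apply: HC; rewrite r1; lra.
apply: le_trans (@star_piece_le r r 1 r2 (lexx _) (ltW r1) (lexx _)) _.
by rewrite lee_fin hat1 subr0 -[2 * _ * _]mulrA [(1 - r) * _]mulrC.
Qed.

(** Let c be the lower constant.  If p lies at relative distance c / 4 from r, the
part of omega-star carried by [r, p) is at most half of the lower bound
c (1 - r) hat omega (r); the other half must come from [p, 1). *)
Lemma star_asymp_Dhat :
  (exists2 C0 : R, 0 < C0 & hat 0 <= C0 * hat (1 / 2)) ->
  asymp_on [set z : R[i] | 1 / 2 <= cmod z < 1]
      (fun z => omega_star omega z)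
      (fun z => (hat (cmod z) * (1 - cmod z))%:E) -> Dhat omega.
Proof.
move=> [C0 C00 h0] [c' [C' [c'0 _ H]]].
pose c := Num.min c' 1.
have c0 : 0 < c by rewrite /c lt_min c'0/=.
have c1 : c <= 1 by rewrite /c ge_min lexx orbT.
have cc : c <= c' by rewrite /c ge_min lexx.
apply: (@Dhat_of_contraction C0 (4 / c) (1 - c / 4)) => //.
- by rewrite divr_gt0.
- by apply/andP; lra.
move=> r /andP[r2 r1].
pose p := r + c / 4 * (1 - r).
have -> : 1 - (1 - c / 4) * (1 - r) = p by rewrite /p; ring.
have [|+ _] := H (Complex r 0).
  by rewrite /= -/(cmod (Complex r 0)) cmod_real ?r2//; lra.
rewrite cmod_real; last by lra.
rewrite /omega_star cmod_real; last by lra.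
have rp : r <= p by rewrite /p; nra.
have p1 : p <= 1 by rewrite /p; nra.
have pE : p - r = c / 4 * (1 - r) by rewrite /p; ring.
rewrite (@integral_itv_split _ _ _ p)//; first last.
- move=> s /andP[rs s1].
  have /andP[h1 _] := @ln_ratio_bounds R r s r2 rs (ltW s1).
  by apply: le_trans h1; lra.
- exact: measurable_ln_ratio.
have A := @star_piece_le r r p r2 (lexx _) rp p1.
have B := @star_piece_le r p 1 r2 rp p1 (lexx _).
move=> /le_trans/(_ (leeD A B)); rewrite -EFinM -EFinD lee_fin hat1 subr0 pE.
have r10 : 0 < 1 - r by lra.
have hr := hat_ge0 omega r; have hp := hat_ge0 omega p.
move=> h; rewrite mulrAC ler_pdivlMr//.
have : c * hat r <= c' * hat r by rewrite ler_wpM2r.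
move: h hr hp; move: (hat r) (hat p) => x y h x0 y0 h'.
have : (c' * x) * (1 - r) <= (c / 2 * (x - y) + 2 * y) * (1 - r) by lra.
rewrite ler_pM2r// => h2.
have : 0 <= c * y by rewrite mulr_ge0// ltW.
by nra.
Qed.

End Star.

(** * The sequence of levels *)

Section Levels.
Context (R : realType) (omega : {finite_measure set (measurableTypeR R) -> \bar R}).
Local Notation hat := (hat omega).

Section Rho.
Context (K : R) (K1 : 1 < K).
Local Notation rho := (rho omega K).

Let K0 : 0 < K. Proof. exact: lt_trans K1. Qed.

Lemma level_le_hat0 n : hat 0 * K ^- n <= hat 0.
Proof. by rewrite ler_piMr ?hat_ge0// invf_le1 ?exprn_gt0// exprn_ege1// ltW. Qed.

Lemma rho_has_sup n :
  has_sup [set r : R | 0 <= r < 1 /\ hat 0 * K ^- n <= hat r].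
Proof.
split; last by exists 1 => y [/andP[_ /ltW]].
by exists 0; split; [rewrite lexx ltr01|exact: level_le_hat0].
Qed.

Lemma rho_ge0 n : 0 <= rho n.
Proof.
apply: (ub_le_sup (rho_has_sup n).2); split; first by rewrite lexx ltr01.
exact: level_le_hat0.
Qed.

Lemma rho_le1 n : rho n <= 1.
Proof. by apply: ge_sup (rho_has_sup n).1 _ => y [/andP[_ /ltW]]. Qed.

(** If hat omega jumps over the level, the equation defining rho has no solution;
still the tail is at least the level before rho and less than it after rho. *)
Lemma hat_below_rho n y : y < rho n -> hat 0 * K ^- n <= hat y.
Proof.
move=> yr; have [s [_ hs] ys] := sup_gt (rho_has_sup n).1 yr.
by apply: (le_trans hs); apply: hat_le; exact: ltW.
Qed.

Lemma hat_above_rho n t : rho n < t -> t < 1 -> hat t < hat 0 * K ^- n.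
Proof.
move=> rt t1; rewrite ltNge; apply/negP => h.
have : t <= rho n.
  apply: (ub_le_sup (rho_has_sup n).2); split => //.
  by rewrite t1 andbT (le_trans (rho_ge0 n))// ltW.
by rewrite leNgt rt.
Qed.
End Rho.

(** For K = C 2 ^ beta, the tail can lose a factor K only if (1 - r) / (1 - t)
exceeds 2. *)
Lemma power_decay_rho :
  (exists C beta : R, [/\ 1 <= C, 0 < beta &
      forall r t : R, 0 <= r -> r <= t -> t < 1 ->
        hat r <= C * ((1 - r) / (1 - t)) `^ beta * hat t]) ->
  exists K C : R, [/\ 1 < K, 1 < C &
      forall n : nat, 1 - rho omega K n >= C * (1 - rho omega K n.+1)].
Proof.
move=> [C [b [C1 b0 H]]].
have b2 : 1 < 2 `^ b :> R.
  by rewrite /powR pnatr_eq0/= expR_gt1 mulr_gt0// ln_gt0// ltr1n.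
pose K := C * 2 `^ b.
have K1 : 1 < K by rewrite /K; nra.
exists K, 2; split => //; first by rewrite ltr1n.
move=> n; rewrite leNgt; apply/negP => lt2.
set r := rho omega K n in lt2 *; set t := rho omega K n.+1 in lt2 *.
have r0 : 0 <= r by exact: rho_ge0.
have r1 : r <= 1 by exact: rho_le1.
(* hat omega may still be large at rho (n + 1) itself, so the power bound is
   applied at a point slightly to the right of it. *)
pose t' := (t + (1 + r) / 2) / 2.
have tt' : t < t' by rewrite /t'; lra.
have t'1 : t' < 1 by rewrite /t'; lra.
have hr : hat 0 * K ^- n <= hat r.
  by apply: hat_left_limit => y; exact: hat_below_rho.
have ht : hat t' < hat 0 * K ^- n.+1 by exact: hat_above_rho.
have K0 : 0 < K by lra.
have Kt : K * hat t' < hat 0 * K ^- n.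
  by rewrite -(ltr_pdivlMl _ _ K0) mulrCA -invfM -exprS.
suff : hat r <= K * hat t' by rewrite leNgt (lt_le_trans Kt).
have h' := hat_ge0 omega t'.
have [rt|rt] := leP r t'; last first.
  apply: (@le_trans _ _ (hat t')); first by apply: hat_le; exact: ltW.
  by rewrite ler_peMl// ltW.
apply: le_trans (H r t' r0 rt t'1) _.
rewrite ler_wpM2r// /K ler_pM2l; last by lra.
apply: powR_le_base; [exact: ltW| |].
  by rewrite divr_ge0//; lra.
by rewrite ler_pdivrMr /t'; lra.
Qed.

(** Let C ^ m > 2, so that m levels more than halve the distance to 1, and let n be
the first index with r <= rho_n.  Then hat omega (r) is at most the level n - 1,
and (1 + r) / 2 lies before rho_(n + m): doubling costs at most K ^ (m + 1). *)
Lemma rho_Dhat :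
  (exists K C : R, [/\ 1 < K, 1 < C &
      forall n : nat, 1 - rho omega K n >= C * (1 - rho omega K n.+1)]) ->
  Dhat omega.
Proof.
move=> [K [C [K1 C1 H]]].
have K0 : 0 < K by lra. have C0 : 0 < C by lra.
have iter m n : C ^+ m * (1 - rho omega K (n + m)) <= 1 - rho omega K n.
  elim: m => [|m IH]; first by rewrite expr0 mul1r addn0.
  apply: le_trans IH; rewrite exprSr -mulrA ler_pM2l ?exprn_gt0// addnS.
  exact: H.
have [m Cm] := exists_expr_gt 2 C1.
exists (K ^+ m.+1); first by rewrite exprn_gt0.
move=> r /andP[r0 r1]; have r10 : 0 < 1 - r by lra.
have jump n : r <= rho omega K n -> hat 0 * K ^- (n + m) <= hat ((1 + r) / 2).
  move=> rn; apply: hat_below_rho => //.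
  have := iter m n; have := rho_le1 K1 (n + m).
  set u := rho omega K (n + m) => u1 hu.
  have : 2 * (1 - u) <= C ^+ m * (1 - u) by rewrite ler_wpM2r ?subr_ge0// ltW.
  have [u1'|] := eqVneq u 1; first by rewrite u1'; lra.
  move=> un; have : 0 < (C ^+ m - 2) * (1 - u).
    by rewrite mulr_gt0 ?subr_gt0// lt_neqAle un.
  by lra.
(* rho_n tends to 1 geometrically *)
have ex : exists n, r <= rho omega K n.
  have [n Cn] := exists_expr_gt (1 - r)^-1 C1; exists n.
  have := iter n 0%N; rewrite add0n.
  have := rho_ge0 K1 0; have := rho_le1 K1 n.
  set u := rho omega K n; move=> u1 v0 hu.
  have : (1 - r)^-1 * (1 - u) <= C ^+ n * (1 - u).
    by rewrite ler_wpM2r ?subr_ge0// ltW.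
  have : (1 - r)^-1 * (1 - u) <= 1 -> 1 - u <= 1 - r by rewrite ler_pdivrMl// mulr1.
  by move=> h1 h2; have := h1 ltac:(lra); lra.
pose n := ex_minn ex.
have hn : hat r <= hat 0 * K ^- n.-1.
  rewrite /n; case: ex_minnP => -[|k] _ mink /=.
    by rewrite expr0 invr1 mulr1 hat_le.
  by apply/ltW/hat_above_rho => //; rewrite ltNge; apply/negP => /mink; rewrite ltnn.
have hj : hat 0 * K ^- (n + m) <= hat ((1 + r) / 2).
  by apply: jump; rewrite /n; case: ex_minnP.
apply: (le_trans hn); rewrite -ler_pdivrMl ?exprn_gt0//; apply: le_trans hj.
rewrite mulrCA ler_wpM2l ?hat_ge0// -invfM -exprD.
rewrite lef_pV2 ?posrE ?exprn_gt0//; apply: ler_weXn2l; first exact: ltW.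
by rewrite addSn -addnS addnC leq_add2l leqSpred.
Qed.

End Levels.

(** * Reciprocal of the tail *)

Section Reciprocal.
Context (R : realType) (omega : {finite_measure set (measurableTypeR R) -> \bar R}).
Local Notation hat := (hat omega).

(** On [2 r - 1, r], of length 1 - r, the integrand is at least the inverse of
2 (1 - r) hat omega (2 r - 1), and hat omega (2 r - 1) <= C hat omega (r). *)
Lemma Dhat_reciprocal_integral : Dhat omega ->
   exists2 C : R, 0 < C & forall r : R, 1 / 2 <= r < 1 ->
     (\int[lebesgue_measure]_(t in `[0%R, r]) (1 / (hat t * (1 - t)))%:E
       >= (C / hat r)%:E)%E.
Proof.
move=> [C C0 HC]; exists (1 / (2 * C)); first by rewrite divr_gt0// mulr_gt0.
move=> r /andP[r2 r1].
have f0 t : 0 <= t <= r -> 0 <= 1 / (hat t * (1 - t)).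
  by move=> /andP[t0 tr]; rewrite divr_ge0// mulr_ge0 ?hat_ge0//; lra.
have [h0|h0] := leP (hat r) 0.
  have -> : hat r = 0 by apply/eqP; rewrite eq_le h0 hat_ge0.
  rewrite invr0 mulr0; apply: integral_ge0 => t /=; rewrite in_itv/= lee_fin.
  exact: f0.
pose u := 2 * r - 1.
have hu : hat u <= C * hat r.
  have := HC u; have -> : (1 + u) / 2 = r by rewrite /u; field.
  by apply; rewrite /u; lra.
have u0 : 0 < hat u by apply: lt_le_trans h0 _; apply: hat_le; rewrite /u; lra.
have hm : lebesgue_measure (`[u, r] : set R) = (1 - r)%:E.
  rewrite lebesgue_measure_itv/= lte_fin ifT; last by rewrite /u; lra.
  by rewrite -EFinB; congr (_%:E); rewrite /u; ring.
have r10 : 0 < 1 - r by lra.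
have d0 : 0 < hat u * (2 * (1 - r)) by rewrite !mulr_gt0.
apply: (@le_trans _ _ ((1 / (hat u * (2 * (1 - r))))%:E *
    lebesgue_measure (`[u, r] : set R))%E).
  rewrite hm -EFinM lee_fin.
  have -> : 1 / (hat u * (2 * (1 - r))) * (1 - r) = (2 * hat u)^-1.
    by field; rewrite !gt_eqF.
  have -> : 1 / (2 * C) / hat r = (2 * (C * hat r))^-1.
    by field; rewrite !gt_eqF.
  by rewrite lef_pV2 ?posrE ?mulr_gt0// ler_pM2l.
apply: integral_ge_cst_on => //.
- by apply: subset_itv; rewrite bnd_simp// /u; lra.
- by rewrite divr_ge0// ltW.
- move=> t /=; rewrite in_itv/= => /andP[ut tr]; rewrite lee_fin !div1r.
  have ht : 0 < hat t by apply: lt_le_trans h0 _; exact: hat_le.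
  rewrite lef_pV2 ?posrE//; last by rewrite mulr_gt0//; lra.
  apply: ler_pM; rewrite ?hat_ge0//; try lra; first exact: hat_le.
  by move: ut; rewrite /u; lra.
Qed.
End Reciprocal.

(** * Integrals over circles *)

Section Circle.
Context (R : realType).
Implicit Types u t b a : R.

Lemma norm_sin_le u : `|sin u| <= `|u|.
Proof.
wlog u0 : u / 0 <= u => [H|].
  have [|/ltW u0] := leP 0 u; first exact: H.
  by rewrite -normrN -sinN -[leRHS]normrN; apply: H; rewrite oppr_ge0.
have [x _ e] : exists2 c, c \in `[0, u] & sin u - sin 0 = cos c * (u - 0).
  apply: MVT_segment => //.
  by apply: derivable_within_continuous => x _; exact: derivable_sin.
rewrite sin0 !subr0 in e; rewrite e normrM ler_piMl//.
exact: cos_max.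
Qed.

Lemma cos_ge1B u : 1 - `|u| <= cos u.
Proof.
wlog u0 : u / 0 <= u => [H|].
  have [|/ltW u0] := leP 0 u; first exact: H.
  by rewrite -cosN -normrN; apply: H; rewrite oppr_ge0.
have [x _ e] : exists2 c, c \in `[0, u] & cos u - cos 0 = - sin c * (u - 0).
  apply: MVT_segment => //.
  by apply: derivable_within_continuous => x _; exact: derivable_cos.
rewrite cos0 subr0 in e.
have -> : cos u = 1 - sin x * u by rewrite -mulNr -e; ring.
rewrite ger0_norm// lerD2l lerN2 ler_piMl//; exact: sin_le1.
Qed.

(** The distance between 1 and rho e ^ (i u). *)
Definition chord (rho u : R) : R :=
  Num.sqrt ((1 - rho * cos u) ^+ 2 + (rho * sin u) ^+ 2).

Lemma chord_sqr rho u : chord rho u ^+ 2 = (1 - rho) ^+ 2 + 2 * rho * (1 - cos u).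
Proof.
rewrite sqr_sqrtr ?addr_ge0 ?sqr_ge0//.
have -> : (rho * sin u) ^+ 2 = rho ^+ 2 * (1 - cos u ^+ 2).
  by rewrite exprMn sin2cos2.
by ring.
Qed.

Lemma chord_ge rho u : 0 <= rho <= 1 -> 1 - rho <= chord rho u.
Proof.
move=> /andP[r0 r1]; rewrite -(@ler_pXn2r _ 2) ?nnegrE ?sqrtr_ge0 ?subr_ge0//.
rewrite chord_sqr lerDl mulr_ge0 ?subr_ge0 ?cos_le1//.
by rewrite mulr_ge0.
Qed.

(** On the arc |u| <= 1 - rho, both 1 - rho cos u <= 2 (1 - rho) and
|rho sin u| <= 1 - rho. *)
Lemma chord_le rho u : 0 <= rho <= 1 -> `|u| <= 1 - rho ->
  chord rho u <= 3 * (1 - rho).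
Proof.
move=> /andP[r0 r1] ua; rewrite -(@ler_pXn2r _ 2) ?nnegrE ?sqrtr_ge0//; last first.
  by rewrite mulr_ge0// subr_ge0.
rewrite sqr_sqrtr ?addr_ge0 ?sqr_ge0//.
have a0 : 0 <= 1 - rho by lra.
have h1 : (1 - rho * cos u) ^+ 2 <= (2 * (1 - rho)) ^+ 2.
  have := cos_ge1B u; have := cos_le1 u => c1 c2.
  by rewrite lerXn2r ?nnegrE; nra.
have h2 : (rho * sin u) ^+ 2 <= (1 - rho) ^+ 2.
  rewrite -real_normK ?num_real// lerXn2r ?nnegrE//.
  rewrite normrM (ger0_norm r0); apply: le_trans (le_trans (norm_sin_le u) ua).
  by rewrite ler_piMl.
apply: le_trans (lerD h1 h2) _; rewrite !exprMn.
by have := sqr_ge0 (1 - rho); lra.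
Qed.

(** With a = 1 - rho, the function cos u / (a ^ 2 + sin ^ 2 u) has an elementary
primitive.  It dominates the inverse square of the chord where cos u >= 1/2,
since sin ^ 2 u <= 2 (1 - cos u); elsewhere, and for rho <= 1/2, the chord stays
away from 0. *)
Lemma chord_sqrV_le rho u : 0 <= rho < 1 ->
  (chord rho u ^+ 2)^-1 <=
  4 + (if 0 <= cos u then 4 * (cos u / ((1 - rho) ^+ 2 + sin u ^+ 2)) else 0).
Proof.
move=> /andP[r0 r1]; rewrite chord_sqr.
set a := 1 - rho; have a0 : 0 < a by rewrite /a; lra.
have c1 := cos_le1 u; have cN1 := cos_geN1 u.
have a2 : 0 < a ^+ 2 by rewrite exprn_gt0.
have s2 : 0 <= sin u ^+ 2 by exact: sqr_ge0.
have h0 : 0 <= 2 * rho * (1 - cos u) by rewrite !mulr_ge0// subr_ge0.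
set S := if _ then _ else _.
have S0 : 0 <= S.
  by rewrite /S; case: ifP => // c0; rewrite mulr_ge0// divr_ge0// addr_ge0// ltW.
have small D : 1 / 4 <= D -> D^-1 <= 4 + S.
  move=> D4; apply: (@le_trans _ _ 4); last by rewrite lerDl.
  by rewrite -[4]invrK lef_pV2 ?posrE//; lra.
have [r2|r2] := leP rho (1 / 2).
  by apply: small; rewrite /a in a2 *; nra.
have [c2|c2] := leP (cos u) (1 / 2).
  by apply: small; nra.
rewrite /S ifT; last by lra.
apply: (@le_trans _ _ (4 * (cos u / (a ^+ 2 + sin u ^+ 2)))); last by rewrite lerDr.
have D0 : 0 < a ^+ 2 + sin u ^+ 2 by lra.
rewrite mulrA ler_pdivlMr// ler_pdivrMl; last by lra.
rewrite sin2cos2.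
have h1 : 1 - cos u <= 2 * rho * (1 - cos u) by rewrite ler_peMl; lra.
move: c1 c2 a2 h0 h1; set B := 2 * rho * (1 - cos u); set c := cos u in B *.
move: (a ^+ 2) => A c1 c2 A0 B0 B1.
have h2 : (A + B) * 2 <= (A + B) * (4 * c) by rewrite ler_wpM2l; lra.
have : 0 <= (1 - c) ^+ 2 by exact: sqr_ge0.
by rewrite expr2; lra.
Qed.

Lemma continuous_pole a b : 0 < a ->
  continuous (fun t => cos (t - b) / (a ^+ 2 + sin (t - b) ^+ 2)).
Proof.
move=> a0 t.
have cs : {for t, continuous (fun t => sin (t - b))}.
  by apply: differentiable_continuous; rewrite -derivable1_diffP; apply: ex_derive.
have cc : {for t, continuous (fun t => cos (t - b))}.
  by apply: differentiable_continuous; rewrite -derivable1_diffP; apply: ex_derive.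
apply: (cvgM cc); apply: cvgV.
  by rewrite gt_eqF// ltr_wpDr ?sqr_ge0// exprn_gt0.
by apply: cvgD; [exact: cvg_cst|exact: (cvgM cs cs)].
Qed.

(** The primitive is atan (sin (t - b) / a) / a, which varies by at most pi / a. *)
Lemma integral_pole_le a b : 0 < a ->
  (\int[lebesgue_measure]_(t in `[(b - pi / 2)%R, (b + pi / 2)%R])
     (cos (t - b) / (a ^+ 2 + sin (t - b) ^+ 2))%:E <= (pi / a)%:E)%E.
Proof.
move=> a0; have a20 : 0 < a ^+ 2 by rewrite exprn_gt0.
have dn0 t : a ^+ 2 + sin (t - b) ^+ 2 != 0.
  by rewrite gt_eqF// ltr_wpDr// sqr_ge0.
pose F t := a^-1 * atan (a^-1 * sin (t - b)).
have dsin t : is_derive t 1 (fun t => sin (t - b)) (cos (t - b)).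
  have : is_derive t 1 (fun t => t - b) 1.
    by apply: is_derive_eq; rewrite subr0.
  move=> h; have := @is_derive1_comp R sin (fun t => t - b) t _ _ (is_derive_sin _) h.
  by rewrite mulr1.
have dF t : is_derive t 1 F (cos (t - b) / (a ^+ 2 + sin (t - b) ^+ 2)).
  have h1 : is_derive t 1 (fun t => a^-1 * sin (t - b)) (a^-1 * cos (t - b)).
    exact: is_deriveZ.
  have h2 := @is_derive1_comp R atan (fun t => a^-1 * sin (t - b)) t _ _
    (is_derive1_atan _) h1.
  have h3 := @is_deriveZ _ _ _ _ a^-1 _ _ _ h2.
  apply: is_derive_eq; rewrite /GRing.scale/=.
  have an0 : a != 0 by rewrite gt_eqF.
  field.
  by rewrite dn0 an0.
have dFab t : derivable F t 1 by apply: ex_derive.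
have cF : continuous F.
  by move=> t; apply: differentiable_continuous; rewrite -derivable1_diffP.
rewrite (@continuous_FTC2 _ _ F).
- rewrite -EFinB lee_fin /F.
  have h t : a^-1 * atan t <= a^-1 * (pi / 2).
    by rewrite ler_pM2l ?invr_gt0// ltW// atan_ltpi2.
  have h' t : a^-1 * (- (pi / 2)) <= a^-1 * atan t.
    by rewrite ler_pM2l ?invr_gt0// ltW// atan_gtNpi2.
  apply: le_trans (lerB (h _) (h' _)) _.
  by rewrite mulrN opprK -mulrDr -splitr mulrC.
- by rewrite ltrD2l gtrN// divr_gt0// pi_gt0.
- by apply: continuous_subspaceT; exact: continuous_pole.
- split => //.
  + by apply: cvg_at_right_filter; exact: cF.
  + by apply: cvg_at_left_filter; exact: cF.
- by move=> t _; rewrite derive1E; apply: derive_val.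
Qed.
End Circle.

Section DiscKernel.
Context (R : realType).
Implicit Types u t phi m r lam : R.

(** For t in [0, 2 pi) and phi in [- pi, pi] the difference t - phi ranges over
[- pi, 3 pi], where the cosine is positive on two intervals only. *)
Lemma cos_le0_gap u : - pi <= u -> u <= 3 * pi ->
  ~~ (- (pi / 2) <= u <= pi / 2) -> ~~ (3 * pi / 2 <= u <= 5 * pi / 2) ->
  cos u <= 0.
Proof.
have p0 := @pi_gt0 R.
move=> u1 u2; rewrite !negb_and -!ltNge => h1 h2.
have N : cos u = - cos (u - pi) by rewrite -{1}(subrK pi u) cosDpi.
have [l|l] := ltP u (- (pi / 2)).
  have -> : cos u = - cos (u + pi) by rewrite cosDpi opprK.
  by rewrite oppr_le0 cos_ge0_pihalf//; lra.
have {h1} l' : pi / 2 < u by move: h1; rewrite ltNge l.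
have [g|g] := ltP u (3 * pi / 2).
  by rewrite N oppr_le0 cos_ge0_pihalf//; lra.
have {h2} g' : 5 * pi / 2 < u by move: h2; rewrite ltNge g.
rewrite N -(subrK (pi *+ 2) (u - pi)) cosD2pi oppr_le0 cos_ge0_pihalf//.
by rewrite [pi *+ 2]mulr2n; lra.
Qed.

Lemma integral_patch_le (D I : set R) (f : R -> \bar R) :
  (forall t, I t -> (0 <= f t)%E) ->
  (\int[lebesgue_measure]_(t in D) (f \_ I) t <= \int[lebesgue_measure]_(t in I) f t)%E.
Proof.
move=> f0; rewrite integral_mkcond [leRHS]integral_mkcond.
have p0 t : (0 <= (f \_ I) t)%E by apply: erestrict_ge0.
by apply: integral_le_pointwise => t _; rewrite patchE; case: ifP.
Qed.

Lemma chord_gt0 (rho u : R) : 0 <= rho < 1 -> 0 < chord rho u.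
Proof.
move=> /andP[r0 r1]; apply: lt_le_trans (chord_ge _ _); first by rewrite subr_gt0.
by rewrite r0 ltW.
Qed.

(** Lowers the exponent lam + 1 to 2, at the price of powers of the minimum 1 - rho of
the chord. *)
Lemma chord_kernel_le lam (rho u : R) : 1 <= lam -> 0 <= rho < 1 ->
  1 / chord rho u `^ (lam + 1) <= (1 - rho) `^ (1 - lam) * (chord rho u ^+ 2)^-1.
Proof.
move=> lam1 r01; have N0 := chord_gt0 u r01.
have NA : 1 - rho <= chord rho u by apply: chord_ge; lra.
have a0 : 0 < 1 - rho by lra.
have -> : lam + 1 = (lam - 1) + 2%:R by ring.
rewrite powRD; last by apply/implyP => _; rewrite gt_eqF.
rewrite powR_mulrn ?(ltW N0)// div1r invfM -[1 - lam]opprB powRN.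
rewrite ler_wpM2r ?invr_ge0 ?exprn_ge0 ?(ltW N0)//.
by rewrite lef_pV2 ?posrE ?powR_gt0// powR_le_base//; lra.
Qed.

(** The integrand is at most a constant plus two poles, centred at phi and
phi + 2 pi, each of integral at most pi / (1 - rho) after the exponent has been
lowered to 2. *)
Lemma circle_integral_le lam (rho phi : R) : 1 <= lam -> 0 <= rho < 1 ->
  - pi <= phi <= pi ->
  (\int[lebesgue_measure]_(t in `[0%R, (2 * pi)%R[)
     (1 / chord rho (t - phi) `^ (lam + 1))%:E
   <= (16 * pi * (1 - rho) `^ (- lam))%:E)%E.
Proof.
move=> lam1 r01 /andP[ph1 ph2]; have p0 := @pi_gt0 R.
set a := 1 - rho; have a0 : 0 < a by rewrite /a; lra.
have a1 : a <= 1 by rewrite /a; lra.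
pose K := a `^ (1 - lam); have K0 : 0 < K by rewrite powR_gt0.
pose h b t := cos (t - b) / (a ^+ 2 + sin (t - b) ^+ 2).
pose I b : set R := [set` `[b - pi / 2, b + pi / 2]].
have h0 b t : I b t -> 0 <= h b t.
  rewrite /I/= in_itv/= => tb; rewrite /h divr_ge0 ?addr_ge0 ?sqr_ge0//.
  by apply: cos_ge0_pihalf; lra.
pose g b t := (K * 4 * h b t)%:E.
pose G b : R -> \bar R := g b \_ (I b).
have g0 b t : I b t -> (0 <= g b t)%E.
  by move=> /h0 ?; rewrite lee_fin mulr_ge0// mulr_ge0// ltW.
have mh b : measurable_fun setT (h b).
  by apply: continuous_measurable_fun; exact: continuous_pole.
have mg b : measurable_fun setT (g b).
  by apply/measurable_EFinP; apply: measurable_funM => //; exact: mh.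
have mI b : measurable (I b : set (measurableTypeR R)).
  exact: measurable_itv.
have mgI b (D : set R) : measurable_fun D (G b).
  apply: measurable_funTS; apply/(measurable_restrictT _ (mI b)).
  by apply: measurable_funTS; exact: mg.
have gI0 b t : (0 <= G b t)%E by apply: erestrict_ge0; exact: g0.
have intg b (D : set R) :
    (\int[lebesgue_measure]_(t in D) G b t <= (K * 4 * (pi / a))%:E)%E.
  apply: le_trans (integral_patch_le _ (@g0 b)) _.
  rewrite (_ : \int[_]_(t in _) _ =
      (K * 4)%:E * \int[lebesgue_measure]_(t in I b) (h b t)%:E)%E; last first.
    rewrite -ge0_integralZl_EFin//.
    - by move=> t /h0; rewrite lee_fin.
    - by apply/measurable_EFinP; apply: measurable_funTS; exact: mh.
    - by rewrite mulr_ge0// ltW.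
  rewrite [leRHS]EFinM; apply: lee_wpmul2l; last exact: integral_pole_le.
  by rewrite lee_fin mulr_ge0// ltW.
pose psi := phi + pi *+ 2.
have hper t : h psi t = h phi t.
  have e : t - phi = (t - psi) + pi *+ 2 by rewrite /psi; ring.
  by rewrite /h e cosD2pi sinD2pi.
(* G phi and G psi are the two poles, cut off where the cosine is negative *)
apply: (@le_trans _ _ (\int[lebesgue_measure]_(t in `[0%R, (2 * pi)%R[)
   ((K * 4)%:E + (G phi t + G psi t)))%E).
  apply: integral_le_pointwise => t /=; rewrite in_itv/= => /andP[t0 t2].
    by rewrite lee_fin divr_ge0// powR_ge0.
  apply: (@le_trans _ _ (K * 4 + K * (if 0 <= cos (t - phi) then 4 * h phi t else 0))%:E).
    rewrite lee_fin -mulrDr; apply: le_trans (chord_kernel_le _ lam1 r01) _.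
    by rewrite ler_pM2l//; exact: chord_sqrV_le.
  rewrite EFinD leeD2l//.
  have gp : 0 <= h phi t -> ((K * (4 * h phi t))%:E = g phi t)%E by rewrite /g mulrA.
  have rest_ge : (0 <= G phi t + G psi t)%E.
    by rewrite adde_ge0.
  case: ifPn => [c0|_]; last by rewrite mulr0.
  have [t1|t1] := boolP (- (pi / 2) <= t - phi <= pi / 2).
    have It : I phi t by rewrite /I/= in_itv/=; lra.
    by rewrite {1}/G patchE ifT ?inE// /g mulrA leeDl.
  have [t3|t3] := boolP (3 * pi / 2 <= t - phi <= 5 * pi / 2).
    have It : I psi t by rewrite /I/psi/= in_itv/= [pi *+ 2]mulr2n; lra.
    by rewrite {2}/G patchE ifT ?inE// /g hper mulrA leeDr.
  have c0' : cos (t - phi) <= 0 by apply: cos_le0_gap => //; lra.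
  have -> : h phi t = 0.
    by rewrite /h (_ : cos (t - phi) = 0) ?mul0r//; apply/eqP; rewrite eq_le c0 c0'.
  by rewrite !mulr0.
rewrite ge0_integralD//; first last.
- by apply: emeasurable_funD; exact: mgI.
- by move=> t _; rewrite adde_ge0.
- by move=> t _; rewrite lee_fin mulr_ge0// ltW.
rewrite ge0_integralD//; [|exact: mgI|exact: mgI].
have mD : lebesgue_measure (`[0%R, (2 * pi)%R[ : set R) = (2 * pi)%:E.
  rewrite lebesgue_measure_itv/= lte_fin ifT; last by rewrite mulr_gt0.
  by rewrite oppr0 addr0.
have A : (\int[lebesgue_measure]_(t in `[0%R, (2 * pi)%R[) (K * 4)%:E =
    (K * 4 * (2 * pi))%:E)%E.
  by rewrite [RHS]EFinM -mD; exact: integral_cst.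
rewrite A; apply: le_trans (leeD2l _ (leeD (intg _ _) (intg _ _))) _.
rewrite -!EFinD lee_fin.
have Ka : a `^ (- lam) = K / a.
  rewrite /K -[in X in X / a](addrK (-1) (1 - lam)).
  rewrite -(powR_inv1 (ltW a0)) -powRD; last by apply/implyP => _; rewrite gt_eqF.
  by congr (_ `^ _); ring.
rewrite Ka.
have KKa : K <= K / a by rewrite ler_pdivlMr// ler_piMr// ltW.
have : K * pi <= K / a * pi by rewrite ler_pM2r.
have -> : K * 4 * (pi / a) = 4 * (K / a * pi) by field; rewrite gt_eqF.
by lra.
Qed.

(** An arc of length 1 - rho next to the direction phi suffices, as the chord is at
most 3 (1 - rho) on it. *)
Lemma circle_integral_ge lam (rho phi : R) : 0 <= lam -> 0 <= rho < 1 ->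
  - pi <= phi <= pi ->
  ((3 `^ (- (lam + 1)) * (1 - rho) `^ (- lam))%:E <=
   \int[lebesgue_measure]_(t in `[0%R, (2 * pi)%R[)
     (1 / chord rho (t - phi) `^ (lam + 1))%:E)%E.
Proof.
move=> lam0 r01 /andP[ph1 ph2]; have p2 := @pi_ge2 R.
set a := 1 - rho; have a0 : 0 < a by rewrite /a; lra.
have a1 : a <= 1 by rewrite /a; lra.
have E1 : 3 `^ (- (lam + 1)) * a `^ (- lam) = (3 * a) `^ (- (lam + 1)) * a.
  rewrite powRM ?(ltW a0)// -mulrA; congr (_ * _).
  rewrite -[X in _ = _ * X](powRr1 (ltW a0)) -powRD; last first.
    by apply/implyP => _; rewrite gt_eqF.
  by congr (_ `^ _); ring.
have [b ab0 ab] : exists2 b, 0 <= b /\ b + a <= 2 * pi &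
    forall t, b <= t < b + a -> chord rho (t - phi) <= 3 * a.
  have [q0|q0] := leP 0 phi.
    exists phi; first by split => //; lra.
    move=> t /andP[t1 t2]; apply: chord_le; first lra.
    by rewrite ler_norml; rewrite -/a; lra.
  (* for phi < 0 the arc ends at phi + 2 pi, to stay inside [0, 2 pi) *)
  exists (phi + pi *+ 2 - a); first by rewrite [pi *+ 2]mulr2n; split; lra.
  move=> t /andP[t1 t2].
  have -> : chord rho (t - phi) = chord rho (t - phi - pi *+ 2).
    rewrite -[in LHS](subrK (pi *+ 2) (t - phi)) /chord.
    by rewrite cosD2pi sinD2pi.
  apply: chord_le; first lra.
  by move: t1 t2; rewrite [pi *+ 2]mulr2n ler_norml -/a; lra.
have mE : lebesgue_measure (`[b, b + a[ : set R) = a%:E.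
  rewrite lebesgue_measure_itv/= lte_fin ifT ?ltrDl//.
  by rewrite -EFinB; congr (_%:E); ring.
rewrite E1 EFinM -mE; apply: integral_ge_cst_on => //.
- by apply: subset_itv; rewrite bnd_simp; case: ab0.
- exact: powR_ge0.
- by move=> t _; rewrite lee_fin divr_ge0// powR_ge0.
- move=> t /=; rewrite in_itv/= => /ab tb; rewrite lee_fin powRN div1r.
  have c0 := chord_gt0 (t - phi) r01.
  rewrite lef_pV2 ?posrE ?powR_gt0//; last by rewrite mulr_gt0.
  by apply: powR_le_base => //; [lra|exact: ltW].
Qed.

Lemma cmod_kernel m phi r t :
  cmod (1 - conjc (Complex (m * cos phi) (m * sin phi)) *
    Complex (r * cos t) (r * sin t)) = chord (m * r) (t - phi).
Proof. by rewrite /= /chord cosB sinB; congr (Num.sqrt _); ring. Qed.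

End DiscKernel.

(** * Integrals over the disc *)

Section Disc.
Context (R : realType) (omega : {finite_measure set (measurableTypeR R) -> \bar R}).
Local Notation hat := (hat omega).

(** What the integral over the disc becomes, up to constants, after integration over
the circles |z| = r. *)
Definition radial_integral (lam m : R) : \bar R :=
  (\int[omega]_(r in `[0%R, 1%R[) (r * (1 - m * r) `^ (- lam))%:E)%E.

Definition disc_kernel_integral (lam : R) (zeta : R[i]) : \bar R :=
  disc_integral omega (fun z => 1 / cmod (1 - conjc zeta * z) `^ (lam + 1)).

Lemma measurable_radial (lam m a b : R) :
  measurable_fun (`[a, b[ : set (measurableTypeR R))
    (fun r => r * (1 - m * r) `^ (- lam)).
Proof.
apply: measurable_funTS; apply: measurable_funM => //.
apply: (@measurableT_comp _ _ _ _ _ _ (fun x : R => x `^ (- lam))).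
  exact: measurable_powR.
by apply: measurable_funB => //; exact: measurable_funM.
Qed.

Lemma radial_ge0 (lam m r : R) : 0 <= r -> 0 <= r * (1 - m * r) `^ (- lam).
Proof. by move=> r0; rewrite mulr_ge0// powR_ge0. Qed.

Lemma disc_kernel_le (lam : R) (zeta : R[i]) : 1 <= lam -> cmod zeta < 1 ->
  (disc_kernel_integral lam zeta <= 16%:E * radial_integral lam (cmod zeta))%E.
Proof.
move=> lam1; have [phi hphi ->] := polar_form zeta; set m := cmod zeta.
have m0 : 0 <= m := cmod_ge0 zeta.
rewrite /disc_kernel_integral /disc_integral.
have p0 := @pi_gt0 R.
have -> : cmod (Complex (m * cos phi) (m * sin phi)) = m.
  rewrite /= !exprMn -mulrDr cos2Dsin2 mulr1 sqrtr_sqr ger0_norm//.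
move=> m1.
apply: (@le_trans _ _ ((pi^-1)%:E * ((16 * pi)%:E * radial_integral lam m))%E).
  apply: lee_wpmul2l; first by rewrite lee_fin invr_ge0 ltW.
  rewrite /radial_integral -integral_itvZ; first last.
  - by move=> r /andP[r0 _]; exact: radial_ge0.
  - exact: measurable_radial.
  - by rewrite mulr_ge0// ltW.
  apply: integral_le_pointwise => r Dr;
have /andP[r0 r1] : 0 <= r < 1 by move: Dr; rewrite /= in_itv.
    rewrite mule_ge0//; apply: integral_ge0 => t _.
    by rewrite lee_fin divr_ge0// powR_ge0.
  have mr : 0 <= m * r < 1 by rewrite mulr_ge0//=; nra.
  under eq_integral do rewrite cmod_kernel.
  have -> : 16 * pi * (r * (1 - m * r) `^ (- lam)) =
    r * (16 * pi * (1 - m * r) `^ (- lam)) by ring.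
  rewrite EFinM; apply: lee_wpmul2l => //.
  exact: circle_integral_le.
rewrite muleA -EFinM (_ : pi^-1 * (16 * pi) = 16)//.
by rewrite mulrCA mulVf ?mulr1// gt_eqF.
Qed.

Lemma disc_kernel_ge (lam : R) (zeta : R[i]) : 0 <= lam -> cmod zeta < 1 ->
  ((pi^-1 * 3 `^ (- (lam + 1)))%:E * radial_integral lam (cmod zeta)
    <= disc_kernel_integral lam zeta)%E.
Proof.
move=> lam1; have [phi hphi ->] := polar_form zeta; set m := cmod zeta.
have m0 : 0 <= m := cmod_ge0 zeta.
rewrite /disc_kernel_integral /disc_integral.
have p0 := @pi_gt0 R.
have -> : cmod (Complex (m * cos phi) (m * sin phi)) = m.
  rewrite /= !exprMn -mulrDr cos2Dsin2 mulr1 sqrtr_sqr ger0_norm//.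
move=> m1.
rewrite EFinM -muleA; apply: lee_wpmul2l; first by rewrite lee_fin invr_ge0 ltW.
rewrite /radial_integral -integral_itvZ; first last.
- by move=> r /andP[r0 _]; exact: radial_ge0.
- exact: measurable_radial.
- exact: powR_ge0.
apply: integral_le_pointwise => r Dr;
have /andP[r0 r1] : 0 <= r < 1 by move: Dr; rewrite /= in_itv.
  by rewrite lee_fin mulr_ge0 ?powR_ge0// radial_ge0.
have mr : 0 <= m * r < 1 by rewrite mulr_ge0//=; nra.
under eq_integral do rewrite cmod_kernel.
rewrite mulrCA EFinM; apply: lee_wpmul2l => //.
exact: circle_integral_ge.
Qed.

(** The kernel is 1 at zeta = 0. *)
Lemma disc_kernel0_le (lam : R) : 0 <= lam ->
  (disc_kernel_integral lam 0%R <= 2%:E * \int[omega]_(r in `[0%R, 1%R[) r%:E)%E.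
Proof.
move=> lam0; have p0 := @pi_gt0 R; rewrite /disc_kernel_integral /disc_integral.
apply: (@le_trans _ _ ((pi^-1)%:E *
    ((2 * pi)%:E * \int[omega]_(r in `[0%R, 1%R[) r%:E))%E).
  apply: lee_wpmul2l; first by rewrite lee_fin invr_ge0 ltW.
  rewrite -(@integral_itvZ _ _ _ _ _ (fun r => r)); first last.
  - by move=> r /andP[].
  - exact: measurable_funTS.
  - by rewrite mulr_ge0// ltW.
  apply: integral_le_pointwise => r Dr;
have /andP[r0 r1] : 0 <= r < 1 by move: Dr; rewrite /= in_itv.
    rewrite mule_ge0//; apply: integral_ge0 => t _.
    by rewrite lee_fin divr_ge0// powR_ge0.
  rewrite [2 * pi * r]mulrC EFinM; apply: lee_wpmul2l => //.
  have mD : lebesgue_measure (`[0%R, (2 * pi)%R[ : set R) = (2 * pi)%:E.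
    rewrite lebesgue_measure_itv/= lte_fin ifT; last by rewrite mulr_gt0.
    by rewrite oppr0 addr0.
  rewrite -mD -[leRHS]mul1e; apply: integral_le_cst_on => // t _.
    by rewrite lee_fin divr_ge0// powR_ge0.
  rewrite (_ : cmod _ = 1) ?powR1 ?divr1//.
  by rewrite /= !(mul0r, oppr0, addr0, subr0) expr1n expr0n/= addr0 sqrtr1.
rewrite muleA -EFinM (_ : pi^-1 * (2 * pi) = 2)//.
by rewrite mulrCA mulVf ?mulr1// gt_eqF.
Qed.

(** With t = |zeta|, the upper bound splits the radial integral at t: on [0, t) use
1 - t r >= 1 - r and the integral of ((1 - t) / (1 - r)) ^ lam, on [t, 1) use
1 - t r >= 1 - t.  The lower bound keeps [max(t, 1/2), 1), where
1 - t r <= 2 (1 - t) and r >= 1/2. *)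
Lemma Dhat_disc_asymp : Dhat omega ->
  exists2 lambda : R, 0 <= lambda &
      asymp_on [set zeta : R[i] | cmod zeta < 1]
        (fun zeta => disc_integral omega
           (fun z => 1 / cmod (1 - conjc zeta * z) `^ (lambda + 1)))
        (fun zeta =>
           (hat (cmod zeta) / (1 - cmod zeta) `^ lambda)%:E).
Proof.
move=> D; have [C0 C00 h0] := Dhat_half_mass D.
have [C [lam [Cp lam1 H]]] := Dhat_ratio_integral D.
have lam0 : 0 <= lam by lra.
have p0 := @pi_gt0 R.
pose k : R := pi^-1 * 3 `^ (- (lam + 1)).
have k0 : 0 < k by rewrite mulr_gt0 ?invr_gt0// powR_gt0.
have two0 : 0 < 2 `^ (- lam) :> R by rewrite powR_gt0.
exists lam => //.
exists (k * (1 / 2 * 2 `^ (- lam) / (C0 + 1))), (16 * (C + 1)); split.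
- by rewrite mulr_gt0// !divr_gt0// ?mulr_gt0//; lra.
- by rewrite mulr_gt0//; lra.
move=> zeta; rewrite /= => z1.
have lower := disc_kernel_ge lam0 z1; have upper := disc_kernel_le lam1 z1.
rewrite -/(disc_kernel_integral lam zeta).
have t0 := cmod_ge0 zeta; move: (cmod zeta) z1 t0 lower upper => t t1 t0.
have a0 : 0 < 1 - t by lra.
pose P := (1 - t) `^ (- lam); have P0 : 0 < P by rewrite powR_gt0.
have -> : hat t / (1 - t) `^ lam = hat t * P by rewrite /P powRN.
have ht := hat_ge0 omega t.
split.
  apply: le_trans lower => {upper H D}; rewrite -/k.
  apply: (@le_trans _ _ (k%:E * ((1 / 2 * 2 `^ (- lam) / (C0 + 1)) * (hat t * P))%:E)%E).
    by rewrite -!EFinM lee_fin -[leLHS]mulrA.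
  apply: lee_wpmul2l; first by rewrite lee_fin ltW.
  pose b := Num.max t (1 / 2).
  have bt : t <= b by rewrite /b le_max lexx.
  have b2 : 1 / 2 <= b by rewrite /b le_max lexx orbT.
  have b1 : b < 1 by rewrite /b gt_max t1; lra.
  have hb : hat t <= (C0 + 1) * hat b.
    have hb0 := hat_ge0 omega b.
    have [tb|tb] := leP t (1 / 2).
      have bE : b = 1 / 2 by apply/max_idPr.
      rewrite bE in hb0 *; have : hat t <= hat 0 by apply: hat_le.
      by lra.
    have -> : b = t by apply/max_idPl; exact: ltW.
    by rewrite mulrDl mul1r lerDr mulr_ge0// ltW.
  apply: (@le_trans _ _ ((1 / 2 * 2 `^ (- lam) * P) * (hat b - hat 1))%:E).
    rewrite lee_fin hat1 subr0 mulrAC ler_pdivrMr; last by lra.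
    have -> : 1 / 2 * 2 `^ (- lam) * (hat t * P) =
      (1 / 2 * 2 `^ (- lam) * P) * hat t by ring.
    have -> : 1 / 2 * 2 `^ (- lam) * P * hat b * (C0 + 1) =
      (1 / 2 * 2 `^ (- lam) * P) * ((C0 + 1) * hat b) by ring.
    by rewrite ler_pM2l// !mulr_gt0//; lra.
  apply: integral_itv_ge => //.
  - by rewrite !mulr_ge0// ltW.
  - lra.
  - exact: ltW.
  - by move=> r /andP[r0 _]; exact: radial_ge0.
  move=> r /andP[br r1]; rewrite -mulrA.
  apply: ler_pM => //; first by rewrite mulr_ge0// ltW.
    exact: le_trans br.
  have tr1 : 0 < 1 - t * r by nra.
  rewrite /P -powRM ?(ltW a0)// !powRN lef_pV2 ?posrE ?powR_gt0//; last by rewrite mulr_gt0.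
  by apply: powR_le_base => //; [exact: ltW|nra].
apply: (le_trans upper) => {lower upper D}.
apply: (@le_trans _ _ (16%:E * ((C + 1) * (hat t * P))%:E)%E); last first.
  by rewrite -!EFinM lee_fin [leLHS]mulrA.
apply: lee_wpmul2l => //.
rewrite /radial_integral (@integral_itv_split _ _ _ t); first last.
- by move=> r /andP[r0 _]; exact: radial_ge0.
- exact: measurable_radial.
- exact: ltW.
- exact: t0.
rewrite mulrDl mul1r EFinD; apply: leeD; last first.
  have -> : hat t * P = P * (hat t - hat 1) by rewrite hat1 subr0 mulrC.
  apply: integral_itv_le => //; first exact: ltW.
  move=> r /andP[tr r1]; have r0 : 0 <= r by lra.
  rewrite radial_ge0//= -[leRHS]mul1r; apply: ler_pM => //; [exact: powR_ge0|exact: ltW|].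
  rewrite /P !powRN lef_pV2 ?posrE ?powR_gt0//; last by nra.
  by apply: powR_le_base => //; nra.
apply: (@le_trans _ _ (P%:E * \int[omega]_(s in `[0%R, t[) (((1 - t) / (1 - s)) `^ lam)%:E)%E).
  rewrite -integral_itvZ; first last.
  - by move=> s _; exact: powR_ge0.
  - by apply: measurable_ratio_powR; exact: ltW.
  - exact: ltW.
  apply: integral_itv_mono => r /andP[r0 rt].
  rewrite radial_ge0//=.
  have r10 : 0 < 1 - r by lra.
  have -> : P * ((1 - t) / (1 - r)) `^ lam = 1 * (1 - r) `^ (- lam).
    rewrite /P powRM ?invr_ge0 ?(ltW a0) ?(ltW r10)// powRN mulrA mulVf ?gt_eqF ?powR_gt0//.
    by rewrite -(powR_inv1 (ltW r10)) -powRrM mulN1r.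
  apply: ler_pM => //; [exact: powR_ge0|lra|].
  rewrite !powRN lef_pV2 ?posrE ?powR_gt0//; last by nra.
  by apply: powR_le_base => //; nra.
have -> : C * (hat t * P) = P * (C * hat t) by ring.
rewrite EFinM; apply: lee_wpmul2l; first by rewrite lee_fin ltW.
by apply: H; rewrite t0.
Qed.

(** For t = (1 + r) / 2 the weight s (1 - t s) ^ - lam is at least a multiple of
(1 - t) ^ - lam on [r, t), so the upper estimate at |zeta| = t bounds the mass of
[r, t) by hat omega (t).  The comparison of the masses of [0, 1) and [1/2, 1)
needs the lower estimate as well: hat omega (0) is at most a multiple of
\int r d omega by the estimate at 0, and that integral is at most a multiple
of hat omega (1/2) by the estimate at 1/2. *)
Lemma disc_asymp_Dhat :
  (exists2 lambda : R, 0 <= lambda &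
      asymp_on [set zeta : R[i] | cmod zeta < 1]
        (fun zeta => disc_integral omega
           (fun z => 1 / cmod (1 - conjc zeta * z) `^ (lambda + 1)))
        (fun zeta =>
           (hat (cmod zeta) / (1 - cmod zeta) `^ lambda)%:E)) -> Dhat omega.
Proof.
move=> [lam lam0 [c [C [c0 Cp H]]]].
have p0 := @pi_gt0 R.
pose k : R := pi^-1 * 3 `^ (- (lam + 1)).
have k0 : 0 < k by rewrite mulr_gt0 ?invr_gt0// powR_gt0.
have W t : 0 <= t < 1 ->
    (radial_integral lam t <= (C / k * (hat t * (1 - t) `^ (- lam)))%:E)%E.
  move=> /andP[t0 t1]; have ct : cmod (Complex t 0) = t by exact: cmod_real.
  have [|_] := H (Complex t 0); first by rewrite /= -/(cmod (Complex t 0)) ct.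
  have := @disc_kernel_ge lam (Complex t 0) lam0.
  rewrite ct => /(_ t1) h1 h2; have := le_trans h1 h2.
  rewrite -/k -EFinM muleC -lee_pdivlMr// => /le_trans; apply.
  by rewrite lee_fin powRN mulrAC.
have two0 : 0 < 2 `^ lam :> R by rewrite powR_gt0.
have four0 : 0 < 4 `^ lam :> R by rewrite powR_gt0.
have half0 : hat 0 <= (2 * (C / k * 2 `^ lam) / c) * hat (1 / 2).
  have [|h1 _] := H 0; first by rewrite /= expr0n/= addr0 sqrtr0.
  have cz : cmod (0 : R[i]) = 0 by rewrite /= expr0n/= addr0 sqrtr0.
  have := le_trans h1 (disc_kernel0_le lam0).
  have h2 : (\int[omega]_(r in `[0%R, 1%R[) r%:E <=
      (C / k * 2 `^ lam * hat (1 / 2))%:E)%E.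
    have W2 : 0 <= (1 / 2 : R) < 1 by lra.
    apply: le_trans (le_trans (W _ W2) _).
      apply: integral_itv_mono => r /andP[r0 r1]; rewrite r0/= ler_peMr//.
      rewrite powRN invf_ge1 ?powR_gt0//; last by lra.
      by apply: powR_le1 => //; lra.
    have -> : (1 - 1 / 2 : R) = 2^-1 by field.
    rewrite -[2^-1](powR_inv1 (ler0n R 2)) -powRrM mulN1r opprK lee_fin.
    by rewrite -[leRHS]mulrA [2 `^ lam * _]mulrC.
  move=> h3; have := le_trans h3 (lee_wpmul2l _ h2); rewrite cz subr0 powR1 divr1.
  rewrite -!EFinM !lee_fin => /(_ (ler0n _ _)).
  by rewrite -[in X in X -> _]ler_pdivlMl// => h4; apply: (le_trans h4); lra.
clear H; apply: (@Dhat_of_upper_half _ _ (2 * (C / k * 2 `^ lam) / c)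
   (2 * (4 `^ lam * (C / k)) + 1)) => //.
- by rewrite divr_gt0// !mulr_gt0// invr_gt0.
- by rewrite addr_gt0// !mulr_gt0// invr_gt0.
move=> r /andP[r2 r1]; set t := (1 + r) / 2.
have t1 : t < 1 by rewrite /t; lra.
have rt : r <= t by rewrite /t; lra.
have a0 : 0 < 1 - t by lra.
pose P := (1 - t) `^ (- lam); have P0 : 0 < P by rewrite powR_gt0.
have Wt : 0 <= t < 1 by rewrite /t; lra.
have kP0 : 0 <= 1 / 2 * (4 `^ (- lam) * P).
  by rewrite !mulr_ge0// ?powR_ge0// ltW.
have r0 : 0 <= r by lra.
have weight s : r <= s < t ->
    1 / 2 * (4 `^ (- lam) * P) <= s * (1 - t * s) `^ (- lam).
  move=> /andP[rs st]; have s2 : 1 / 2 <= s by exact: le_trans rs.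
  have ts : 0 < 1 - t * s by clear -st t1 r0 rs; nra.
  have ts4 : 1 - t * s <= 4 * (1 - t) by clear -st t1 r0 rs rt; rewrite /t in st t1 rt *; nra.
  apply: ler_pM => //; first by rewrite mulr_ge0 ?powR_ge0// ltW.
  rewrite /P -powRM ?(ltW a0)// !powRN lef_pV2 ?posrE ?powR_gt0//;
    last by rewrite mulr_gt0.
  by apply: powR_le_base => //; exact: ltW.
have := le_trans (integral_itv_ge omega kP0 r0 rt (ltW t1) (ltW t1)
  (fun s hs => radial_ge0 lam t (proj1 (andP hs))) weight) (W t Wt).
rewrite -/P lee_fin powRN => h.
have h' : (hat r - hat t) * (1 / 2 * ((4 `^ lam)^-1 * P)) <=
   (2 * (4 `^ lam * (C / k)) * hat t) * (1 / 2 * ((4 `^ lam)^-1 * P)).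
  rewrite mulrC; apply: (le_trans h).
  by rewrite le_eqVlt; apply/orP; left; apply/eqP; field; rewrite !gt_eqF.
rewrite ler_pM2r in h'; last by rewrite !mulr_gt0// invr_gt0.
by rewrite mulrDl mul1r -lerBlDr.
Qed.
End Disc.

(** * Equivalence of the conditions *)

Section Summary.
Context (R : realType) (omega : {finite_measure set (measurableTypeR R) -> \bar R}).
Local Notation hat := (hat omega).

Lemma Dhat_power_integral : Dhat omega ->
  exists C0 C : R, [/\ 0 < C0, 0 < C,
    hat 0 <= C0 * hat (1 / 2) &
    forall t : R, 0 <= t < 1 ->
      (\int[omega]_(s in `[0%R, t[) (s `^ (1 / (1 - t)))%:E
        <= (C * hat t)%:E)%E].
Proof.
move=> /Dhat_ratio_integral[C [g [C0 g1 H]]].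
apply: ratio_integral_power_integral; exists C, g; split => //.
exact: lt_le_trans g1.
Qed.

Lemma power_integral_Dhat :
  (exists C0 C : R, [/\ 0 < C0, 0 < C,
    hat 0 <= C0 * hat (1 / 2) &
    forall t : R, 0 <= t < 1 ->
      (\int[omega]_(s in `[0%R, t[) (s `^ (1 / (1 - t)))%:E
        <= (C * hat t)%:E)%E]) -> Dhat omega.
Proof. by move=> /power_integral_power_decay /base_power_decay_Dhat. Qed.

Lemma Dhat_moment_growth : Dhat omega ->
  exists C eta : R, [/\ 0 < C, 0 < eta &
    forall x y : R, 0 < x -> x <= y ->
      (moment omega x <= (C * (y / x) `^ eta)%:E * moment omega y)%E].
Proof.
move=> D; apply: moment_growth_of_asymp; first exact: Dhat_power_decay.
exact/power_integral_moment_asymp/Dhat_power_integral.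
Qed.

End Summary.

Theorem lemma2p1 (R : realType)
    (omega : {finite_measure set (measurableTypeR R) -> \bar R})
    (homega : on_unit omega) :
  [<->
    (* (i) *)
    Dhat omega;
    (* (ii) *)
    exists C beta : R, [/\ 1 <= C, 0 < beta &
      forall r t : R, 0 <= r -> r <= t -> t < 1 ->
        hat omega r <= C * ((1 - r) / (1 - t)) `^ beta * hat omega t];
    (* (iii) *)
    exists C gamma : R, [/\ 0 < C, 0 < gamma &
      forall t : R, 0 <= t < 1 ->
        (\int[omega]_(s in `[0%R, t[) (((1 - t) / (1 - s)) `^ gamma)%:E
          <= (C * hat omega t)%:E)%E];
    (* (iv) *)
    exists C0 C : R, [/\ 0 < C0, 0 < C,
      hat omega 0 <= C0 * hat omega (1 / 2) &
      forall t : R, 0 <= t < 1 ->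
        (\int[omega]_(s in `[0%R, t[) (s `^ (1 / (1 - t)))%:E
          <= (C * hat omega t)%:E)%E];
    (* (v); for r = 0 the right-hand side is infinite *)
    exists C0 C : R, [/\ 0 < C0, 0 < C,
      hat omega 0 <= C0 * hat omega (1 / 2) &
      forall r t : R, 0 < r -> r <= t -> t < 1 ->
        hat omega r <= C * r `^ (- (1 / (1 - t))) * hat omega t];
    (* (vi) *)
    (exists2 C0 : R, 0 < C0 & hat omega 0 <= C0 * hat omega (1 / 2)) /\
    asymp_on [set x : R | 1 <= x]
      (fun x => moment omega x) (fun x => (hat omega (1 - 1 / x))%:E);
    (* (vii) *)
    exists2 lambda : R, 0 <= lambda &
      asymp_on [set zeta : R[i] | cmod zeta < 1]
        (fun zeta => disc_integral omega
           (fun z => 1 / cmod (1 - conjc zeta * z) `^ (lambda + 1)))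
        (fun zeta =>
           (hat omega (cmod zeta) / (1 - cmod zeta) `^ lambda)%:E);
    (* (viii) *)
    (exists2 C0 : R, 0 < C0 & hat omega 0 <= C0 * hat omega (1 / 2)) /\
    asymp_on [set z : R[i] | 1 / 2 <= cmod z < 1]
      (fun z => omega_star omega z)
      (fun z => (hat omega (cmod z) * (1 - cmod z))%:E);
    (* (ix) *)
    (exists2 C0 : R, 0 < C0 & hat omega 0 <= C0 * hat omega (1 / 2)) /\
    (exists2 C : R, 0 < C & forall n : nat, (0 < n)%N ->
       (moment omega n%:R <= C%:E * moment omega (2 * n)%:R)%E);
    (* (x) *)
    (exists2 C0 : R, 0 < C0 & hat omega 0 <= C0 * hat omega (1 / 2)) /\
    (exists C eta : R, [/\ 0 < C, 0 < eta &
       forall x y : R, 0 < x -> x <= y ->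
         (moment omega x <= (C * (y / x) `^ eta)%:E * moment omega y)%E]);
    (* (xi) *)
    exists K C : R, [/\ 1 < K, 1 < C &
      forall n : nat, 1 - rho omega K n >= C * (1 - rho omega K n.+1)]
  ] /\
  (Dhat omega ->
   exists2 C : R, 0 < C & forall r : R, 1 / 2 <= r < 1 ->
     (\int[lebesgue_measure]_(t in `[0%R, r]) (1 / (hat omega t * (1 - t)))%:E
       >= (C / hat omega r)%:E)%E).
Proof.
split; last exact: Dhat_reciprocal_integral.
tfae.
- exact: Dhat_power_decay.
- move=> /power_decay_Dhat /Dhat_ratio_integral[C [g [C0 g1 H]]].
  by exists C, g; split => //; exact: lt_le_trans g1.
- exact: ratio_integral_power_integral.
- exact: power_integral_power_decay.
- move=> /base_power_decay_Dhat D; split; first exact: Dhat_half_mass.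
  exact/power_integral_moment_asymp/Dhat_power_integral.
- move=> [h0 /(moment_asymp_power_integral h0) /power_integral_Dhat].
  exact: Dhat_disc_asymp.
- move=> /disc_asymp_Dhat D; split; first exact: Dhat_half_mass.
  exact: Dhat_star_asymp.
- move=> [h0 /(star_asymp_Dhat h0) D]; split => //.
  exact/moment_growth_doubling/Dhat_moment_growth.
- move=> [h0 /(moment_doubling_Dhat h0) D]; split => //.
  exact: Dhat_moment_growth.
- move=> [h0 /moment_growth_doubling /(moment_doubling_Dhat h0)].
  by move=> /Dhat_power_decay; exact: power_decay_rho.
- exact: rho_Dhat.
Qed.
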